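(* Let $\alpha\in[1,2)$. Then, for every $n\geq 1$, $\Phi_{\alpha,n}$ has finite limits as $x\to0^+$ and $x\to1^-$ (denoted $\Phi_{\alpha,n}(0)$ and $\Phi_{\alpha,n}(1)$), and satisfies $$\forall\,n\ge1,\quad|\Phi_{\alpha,n}(1)|=\sqrt{2-\alpha}$$ and $$\Phi_{\alpha,n}(0)\sim c^+_{\nu_\alpha,0}\,\sqrt{\frac{(2-\alpha)\pi}{2}}\,(j_{\nu_\alpha+1,n})^{\frac12+\nu_\alpha}\quad\text{as }n\to+\infty.$$ In particular, the sequence $(\Phi_{\alpha,n}(0))_{n\ge1}$ is unbounded.
   Context: For $\alpha\in[1,2)$ put $\nu_\alpha:=\frac{\alpha-1}{2-\alpha}$. $J_\nu$ is the Bessel function of the first kind of order $\nu$, $J_{\nu}(y)=\sum_{m\ge0}\frac{(-1)^m}{m!\,\Gamma(m+\nu+1)}(y/2)^{2m+\nu}$, and $j_{\nu_\alpha+1,n}$ is the $n$-th positive zero of $J_{\nu_\alpha+1}$. The constant $c^+_{\nu_\alpha,0}:=\frac{1}{2^{\nu_\alpha}\Gamma(\nu_\alpha+1)}$ is the coefficient of $y^{\nu_\alpha}$ in the series of $J_{\nu_\alpha}(y)$. For $n\ge1$, $\Phi_{\alpha,n}(x):=K_{\alpha,n}\,x^{\frac{1-\alpha}{2}}J_{\nu_\alpha}\bigl(j_{\nu_\alpha+1,n}\,x^{\frac{2-\alpha}{2}}\bigr)$, $x\in(0,1)$, where $K_{\alpha,n}>0$ is such that $\|\Phi_{\alpha,n}\|_{L^2(0,1)}=1$.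 The notation $a_n\sim b_n$ means $a_n/b_n\to1$. *)

(* Defs.v *)
From HB Require Import structures.
From mathcomp Require Import all_boot all_order all_algebra.
From mathcomp Require Import all_classical all_reals all_analysis.

Set Implicit Arguments.
Unset Strict Implicit.
Unset Printing Implicit Defensive.

Import Order.TTheory GRing.Theory Num.Theory.
Import numFieldTopology.Exports numFieldNormedType.Exports.

Local Open Scope classical_set_scope.
Local Open Scope card_scope.
Local Open Scope ring_scope.

(* Euler's integral; only used at arguments x >= 1. *)
Definition Gamma {R : realType} (x : R) : R :=
  \int[lebesgue_measure]_(t in `]0, +oo[) (t `^ (x - 1) * expR (- t)).

(* Meant for y >= 0 and nu >= 0: the real power `^ is the usual one only for a
   nonnegative base. *)
Definition besselJ {R : realType} (nu y : R) : R :=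
  limn (series (fun m : nat =>
    (-1) ^+ m / (m`!%:R * Gamma (m%:R + nu + 1)) * (y / 2) `^ (2 * m%:R + nu))).

(* y is a positive zero of f and ]0, y] contains exactly n zeros of f, counted
   without multiplicity; n >= 1 necessarily. *)
Definition is_nth_pos_zero {R : realType} (f : R -> R) (n : nat) (y : R) : Prop :=
  [/\ 0 < y, f y = 0 & [set z | 0 < z <= y /\ f z = 0] #= `I_n].

(* 0 is only the default value of the choice, taken if there is no such zero; the
   same convention is used for K_ below. *)
Definition besselJ_zero {R : realType} (nu : R) (n : nat) : R :=
  xget 0 [set y | is_nth_pos_zero (besselJ nu) n y].

Definition nu_ {R : realType} (alpha : R) : R := (alpha - 1) / (2 - alpha).

(* The coefficient of y ^ nu in the series of besselJ nu y. *)
Definition cplus0 {R : realType} (nu : R) : R := 1 / (2 `^ nu * Gamma (nu + 1)).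

Definition L2norm01 {R : realType} (f : R -> R) : \bar R :=
  ('N[lebesgue_measure]_(2%:E) [EFin \o (f \_ `]0%R, 1%R[)])%E.

Definition Phi_unnormalized {R : realType} (alpha : R) (n : nat) (x : R) : R :=
  x `^ ((1 - alpha) / 2) *
  besselJ (nu_ alpha) (besselJ_zero (nu_ alpha + 1) n * x `^ ((2 - alpha) / 2)).

Definition K_ {R : realType} (alpha : R) (n : nat) : R :=
  xget 0 [set K | 0 < K /\
    L2norm01 (fun x => K * Phi_unnormalized alpha n x) = 1%E].

Definition Phi {R : realType} (alpha : R) (n : nat) (x : R) : R :=
  K_ alpha n * Phi_unnormalized alpha n x.

Definition Phi_at0 {R : realType} (alpha : R) (n : nat) : R :=
  lim (Phi alpha n x @[x --> 0^'+]).

Definition Phi_at1 {R : realType} (alpha : R) (n : nat) : R :=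
  lim (Phi alpha n x @[x --> 1^'-]).

(* Main.v *)
Require Import Defs.
From HB Require Import structures.
From mathcomp Require Import all_boot all_order all_algebra.
From mathcomp Require Import all_classical all_reals all_analysis.
From mathcomp Require Import finmap ring lra measurable_realfun.

Set Implicit Arguments.
Unset Strict Implicit.
Unset Printing Implicit Defensive.

Import Order.TTheory GRing.Theory Num.Theory.
Import numFieldTopology.Exports numFieldNormedType.Exports.

Local Open Scope classical_set_scope.
Local Open Scope ring_scope.

(** Write [nu = nu_ alpha], [kappa = (2 - alpha) / 2], and let [j] be a positive
zero of [J_(nu+1)]. Up to the factor [(y / 2) ^ nu / Gamma (nu + 1)], the
functions [J_nu] and [J_(nu+1)] are [p = bp nu] and [q = bq nu], which are
regular at [0], with [p 0 = 1], [p' = - q] and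
[q' = p - (2 nu + 1) q / y]. The unnormalised eigenfunction is therefore
[cplus0 nu * j ^ nu * p (j x ^ kappa)], so that both limits exist. Lommel's
antiderivative of [y J_nu ^ 2], evaluated where [q j = 0], gives
[p j ^ 2 / (2 - alpha)] for the integral of [p (j x ^ kappa) ^ 2] over [[0, 1]]
([integral_profile]). Hence [|Phi 1| = sqrt (2 - alpha)] and
[Phi 0 = sqrt (2 - alpha) / |p j|], and the asymptotic statement amounts to
[j J_nu (j) ^ 2 --> 2 / pi] along the zeros [j] of [J_(nu+1)]
([bp_at_zeros_lim]).

This constant is obtained without an asymptotic expansion, by carrying it from
the positive real axis, where the same power series give [I_nu], to the
imaginary axis, where they give [J_nu]. Let [a = nu + 1/2] and let
[g = z ^ a exp (- z) P z] with [P] the entire function of [I_nu]. Bessel's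
equation is [g'' + 2 g' = (nu ^ 2 - 1/4) g / z ^ 2]. In the half plane
[Re z >= 0], [|z| >= 1], the sum of [|g' + 2 g| ^ 2] and [|g'| ^ 2] stays bounded,
by Gronwall's inequality along rays ([energy_bounded]). Since
[(g' + 2 g)' = (nu ^ 2 - 1/4) g / z ^ 2], the quantity
[energyX = |g' + 2 g| ^ 2] converges along the real axis ([energyX_cvg]), and on
the circle of radius [r] it differs by [O (1 / r)] between the two axes
([energyX_arc]). At a zero of [J_(nu+1)] on the imaginary axis it is
[j ^ (2 nu + 1) p (j) ^ 2] up to a factor tending to [1].

On the real axis the limit is computed from the amplitude
[lim sqrt x exp (- x) I_nu x] as a function of the order. The recurrence
relations make it 1-periodic in [nu] ([amplitudeS]). Both the coefficients of
[I_nu] and the Gamma function satisfy interpolation inequalities between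
consecutive integers, asymptotically sharp for large orders, which together
with the periodicity force the amplitude to be constant ([amplitude_const]), as
in the Bohr-Mollerup theorem. At order [1/2] everything is explicit, and
[Gamma (3/2) = sqrt pi / 2], that is the Gaussian integral, gives
[1 / sqrt (2 pi)] ([amplitude_half]).

Finally the zeros of [q] can be numbered: they are simple because [p] and [q]
have no common zero ([bpq_gt0]), hence isolated and finite in number in bounded
intervals ([bq_zeros_finite]), and Sturm comparison with a sine shows that they
are unbounded ([bq_oscillates]). So the [n]-th zero exists and tends to
infinity with [n] ([besselJ_zeroP], [besselJ_zero_cvgy]). *)

(** * One-variable calculus *)

Section calculus.
Context {R : realType}.
Implicit Types (f g : R -> R) (x a b df dg k : R).

(** A derivative statement that is not a type class, so that the derivative is
found by following the syntax and never by instance search. *)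
Definition has_derive f x df : Prop := is_derive x 1 f df.

Lemma has_derive_eq f x df dg : has_derive f x df -> df = dg ->
  has_derive f x dg.
Proof. by move=> ? <-. Qed.

Lemma has_derive_cst k x : has_derive (fun=> k) x 0.
Proof. exact: is_derive_cst. Qed.

Lemma has_derive_id x : has_derive (fun y : R => y) x 1.
Proof. exact: is_derive_id. Qed.

Lemma has_derive_add f g x df dg : has_derive f x df -> has_derive g x dg ->
  has_derive (fun y => f y + g y) x (df + dg).
Proof. exact: is_deriveD. Qed.

Lemma has_derive_opp f x df : has_derive f x df ->
  has_derive (fun y => - f y) x (- df).
Proof. exact: is_deriveN. Qed.

Lemma has_derive_mul f g x df dg : has_derive f x df -> has_derive g x dg ->
  has_derive (fun y => f y * g y) x (f x * dg + g x * df).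
Proof. exact: is_deriveM. Qed.

Lemma has_derive_exp f n x df : has_derive f x df ->
  has_derive (fun y => f y ^+ n) x (n%:R * f x ^+ n.-1 * df).
Proof.
move=> fx; have -> : (fun y => f y ^+ n) = f ^+ n.
  by apply/funext => y; rewrite exprfctE.
exact: is_deriveX.
Qed.

Lemma has_derive_inv f x df : f x != 0 -> has_derive f x df ->
  has_derive (fun y => (f y)^-1) x (- (f x) ^- 2 * df).
Proof. exact: is_deriveV. Qed.

Lemma has_derive_comp f g x df dg :
  has_derive f (g x) df -> has_derive g x dg ->
  has_derive (fun y => f (g y)) x (df * dg).
Proof. exact: is_derive1_comp. Qed.

Lemma has_derive_powR x k : 0 < x ->
  has_derive (fun y => y `^ k) x (k * x `^ (k - 1)).
Proof. exact: is_derive1_powR. Qed.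

Lemma has_derive_expR f x df : has_derive f x df ->
  has_derive (fun y => expR (f y)) x (expR (f x) * df).
Proof. by apply: has_derive_comp; exact: is_derive_expR. Qed.

Lemma has_derive_cos f x df : has_derive f x df ->
  has_derive (fun y => cos (f y)) x (- sin (f x) * df).
Proof. by apply: has_derive_comp; exact: is_derive_cos. Qed.

Lemma has_derive_sin f x df : has_derive f x df ->
  has_derive (fun y => sin (f y)) x (cos (f x) * df).
Proof. by apply: has_derive_comp; exact: is_derive_sin. Qed.

Lemma has_derive_continuous f x df : has_derive f x df -> {for x, continuous f}.
Proof.
by move=> [fx _]; apply: differentiable_continuous; exact/derivable1_diffP.
Qed.

Lemma has_derive_within f (df : R -> R) a b :
  (forall x, a <= x <= b -> has_derive f x (df x)) ->
  {within `[a, b], continuous f}.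
Proof.
move=> fdf; apply: derivable_within_continuous => x.
by rewrite in_itv/= => /fdf [].
Qed.

Lemma derive_ge0_le f (df : R -> R) a b : a <= b ->
  (forall x, a <= x <= b -> has_derive f x (df x)) ->
  (forall x, a <= x <= b -> 0 <= df x) -> f a <= f b.
Proof.
move=> ab fdf df0; have cf := has_derive_within fdf.
have [|c cab fab] := @MVT_segment R f df a b ab _ cf.
  by move=> x; rewrite in_itv/= => /andP[ax xb]; apply: fdf; rewrite !ltW.
by rewrite -subr_ge0 fab mulr_ge0 ?subr_ge0 ?df0//; rewrite in_itv/= in cab.
Qed.

Lemma derive_le0_ge f (df : R -> R) a b : a <= b ->
  (forall x, a <= x <= b -> has_derive f x (df x)) ->
  (forall x, a <= x <= b -> df x <= 0) -> f b <= f a.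
Proof.
move=> ab fdf df0; rewrite -lerN2.
apply: (@derive_ge0_le (fun x => - f x) (fun x => - df x)) => // x axb.
- by apply: has_derive_opp; exact: fdf.
- by rewrite oppr_ge0 df0.
Qed.

Lemma derive_norm_le f (df : R -> R) a b M : a <= b ->
  (forall x, a <= x <= b -> has_derive f x (df x)) ->
  (forall x, a <= x <= b -> `|df x| <= M) -> `|f b - f a| <= M * (b - a).
Proof.
move=> ab fdf dfM; have cf := has_derive_within fdf.
have [|c cab ->] := @MVT_segment R f df a b ab _ cf.
  by move=> x; rewrite in_itv/= => /andP[ax xb]; apply: fdf; rewrite !ltW.
rewrite normrM [X in _ * X]ger0_norm ?subr_ge0// ler_wpM2r ?subr_ge0//.
by apply: dfM; rewrite in_itv/= in cab.
Qed.

(** Weighted arithmetic-geometric mean of [u] and [1]. *)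
Lemma powR_le_affine (u p : R) : 0 <= u -> 0 < p < 1 ->
  u `^ p <= p * u + (1 - p).
Proof.
move=> u0 /andP[p0 p1]; have p10 : 0 < 1 - p by rewrite subr_gt0.
have := @conjugate_powR R (u `^ p) 1 p^-1 (1 - p)^-1.
rewrite powR_ge0 ler01 !invr_gt0 p0 p10 !invrK addrC subrK.
move=> /(_ isT isT isT isT erefl).
by rewrite mulr1 powR1 mul1r -powRrM mulfV ?gt_eqF// powRr1// [u * p]mulrC.
Qed.

Lemma powR_div (u v r : R) : 0 <= u -> 0 < v -> (u / v) `^ r = u `^ r / v `^ r.
Proof.
move=> u0 v0; rewrite powRM ?invr_ge0 ?(ltW v0)//; congr (_ * _).
by rewrite -[in LHS]powR_inv1 ?(ltW v0)// -powRrM mulN1r powRN.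
Qed.

Lemma powR_sub1 x k : 0 < x -> x `^ (k - 1) = x `^ k / x.
Proof. by move=> x0; rewrite powRB ?powRr1 ?(ltW x0)// (gt_eqF x0) implybT. Qed.

Lemma has_derive_unique f x df dg :
  has_derive f x df -> has_derive f x dg -> df = dg.
Proof. by move=> [_ <-] [_ <-]. Qed.

Lemma cvg_div_pinfty k : k / x @[x --> +oo] --> (0 : R).
Proof.
rewrite -[X in _ --> X](mulr0 k); apply: cvgM; first exact: cvg_cst.
apply/(gtr0_cvgV0 (f := id)); last exact: cvg_id.
by near=> x; near: x; apply: nbhs_pinfty_gt; exact: num_real.
Unshelve. all: by end_near. Qed.

End calculus.

(** Proves a derivability goal whose derivative is still a metavariable,
following the syntax of the function. *)
Ltac deriv := repeat (match goal with
  (* unification may have eta-contracted the function *)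
  | |- has_derive ( *%R ?k) _ _ => apply: (@has_derive_mul _ (fun=> k) id)
  | |- has_derive GRing.inv _ _ => apply: (@has_derive_inv _ id)
  | |- has_derive -%R _ _ => apply: (@has_derive_opp _ id)
  | |- has_derive expR _ _ => exact: is_derive_expR
  | |- has_derive cos _ _ => exact: is_derive_cos
  | |- has_derive sin _ _ => exact: is_derive_sin
  | |- has_derive id _ _ => apply: has_derive_id
  | |- has_derive _ _ _ => eassumption
  | |- has_derive (fun=> _) _ _ => apply: has_derive_cst
  | |- has_derive (fun x => x) _ _ => apply: has_derive_id
  | |- has_derive (fun _ => _ + _) _ _ => apply: has_derive_add
  | |- has_derive (fun _ => - _) _ _ => apply: has_derive_opp
  | |- has_derive (fun _ => _ * _) _ _ => apply: has_derive_mul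
  | |- has_derive (fun _ => _ ^+ _) _ _ => apply: has_derive_exp
  | |- has_derive (fun _ => _^-1) _ _ => apply: has_derive_inv
  | |- has_derive (fun x => x `^ _) _ _ => apply: has_derive_powR
  | |- has_derive (fun _ => expR _) _ _ => apply: has_derive_expR
  | |- has_derive (fun _ => cos _) _ _ => apply: has_derive_cos
  | |- has_derive (fun _ => sin _) _ _ => apply: has_derive_sin
  end).

(** * Sums of series *)

Section sums.
Context {R : realType}.
Implicit Types (u v : nat -> R) (k : R).

Definition summable_seq u := cvgn (series u).
Definition Sum u : R := limn (series u).

Lemma Sum_zero u : (forall n, u n = 0) -> Sum u = 0.
Proof.
move=> u0; rewrite /Sum (_ : series u = fun=> 0) ?lim_cst//.
by apply/funext => n; rewrite /series/= big1.
Qed.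

Lemma summable_add u v : summable_seq u -> summable_seq v ->
  summable_seq (fun n => u n + v n).
Proof. by move=> cu cv; apply: is_cvg_seriesD. Qed.

Lemma Sum_add u v : summable_seq u -> summable_seq v ->
  Sum (fun n => u n + v n) = Sum u + Sum v.
Proof. by move=> cu cv; apply: lim_seriesD. Qed.

Lemma summable_scale k u : summable_seq u -> summable_seq (fun n => k * u n).
Proof. by move=> cu; apply: is_cvg_seriesZ. Qed.

Lemma Sum_scale k u : summable_seq u -> Sum (fun n => k * u n) = k * Sum u.
Proof. by move=> cu; apply: lim_seriesZ. Qed.

Lemma Sum_lin k u l v : summable_seq u -> summable_seq v ->
  Sum (fun n => k * u n + l * v n) = k * Sum u + l * Sum v.
Proof. by move=> cu cv; rewrite Sum_add ?Sum_scale//; exact: summable_scale. Qed.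

Lemma summable_dom u v : summable_seq v -> (forall n, `|u n| <= v n) -> summable_seq u.
Proof.
move=> cv uv; apply: normed_cvg; apply: series_le_cvg cv => // n.
  exact: normr_ge0.
exact: le_trans (normr_ge0 _) (uv n).
Qed.

Lemma Sum_le u v : summable_seq u -> summable_seq v -> (forall n, u n <= v n) ->
  Sum u <= Sum v.
Proof. by move=> cu cv uv; apply: lim_series_le. Qed.

Lemma Sum_norm_le u v : summable_seq v -> (forall n, `|u n| <= v n) ->
  `|Sum u| <= Sum v.
Proof.
move=> cv uv; have cu : summable_seq (fun n => `|u n|).
  by apply: summable_dom cv _ => n; rewrite normr_id.
apply: le_trans (lim_series_norm cu) _.
by apply: lim_series_le.
Qed.

Lemma Sum_ge0 u : summable_seq u -> (forall n, 0 <= u n) -> 0 <= Sum u.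
Proof.
move=> cu u0; apply: limr_ge => //; apply: nearW => n.
by rewrite /series/=; apply: sumr_ge0.
Qed.

Lemma Sum_ge_first u : summable_seq u -> (forall n, 0 <= u n) -> u 0%N <= Sum u.
Proof.
move=> cu u0; apply: limr_ge => //; near=> n.
have n0 : (0 < n)%N by near: n; exact: nbhs_infty_gt.
rewrite /series/= -(prednK n0) big_nat_recl//= lerDl.
by apply: sumr_ge0.
Unshelve. all: by end_near. Qed.

Lemma seriesS0 u : u 0%N = 0 ->
  (fun n => series u n.+1) = series (fun n => u n.+1).
Proof.
by move=> u0; apply/funext => n; rewrite /series/= big_nat_recl//= u0 add0r.
Qed.

Lemma Sum_behead u : summable_seq u -> u 0%N = 0 -> Sum u = Sum (fun n => u n.+1).
Proof.
move=> cu u0; rewrite /Sum -(seriesS0 u0).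
by apply/esym/cvg_lim => //; rewrite cvg_shiftS.
Qed.

Lemma summable_behead u : u 0%N = 0 -> summable_seq (fun n => u n.+1) -> summable_seq u.
Proof.
move=> u0; rewrite /summable_seq -(seriesS0 u0) => /cvg_ex [l].
by rewrite cvg_shiftS => cl; apply/cvg_ex; exists l.
Qed.

Lemma series_even u : (forall n, u n.*2.+1 = 0) ->
  series (fun n => u n.*2) = (fun n => series u n.*2).
Proof.
move=> u0; apply/funext => n; rewrite /series/=; elim: n => [|n IH].
  by rewrite !big_geq.
by rewrite big_nat_recr//= IH doubleS !big_nat_recr//= u0 addr0.
Qed.

Lemma cvg_double : (fun n => n.*2) @ \oo --> \oo.
Proof.
apply/cvgnyPge => A; near=> n.
by rewrite (@leq_trans n)//; [near: n; exact: nbhs_infty_ge|rewrite -addnn leq_addr].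
Unshelve. all: by end_near. Qed.

Lemma Sum_even u : summable_seq u -> (forall n, u n.*2.+1 = 0) ->
  Sum u = Sum (fun n => u n.*2).
Proof.
move=> cu u0; rewrite /Sum (series_even u0); apply/esym/cvg_lim => //.
exact: (@cvg_comp _ _ _ (fun n => n.*2) (series u) _ _ _ cvg_double cu).
Qed.

Lemma Sum_odd u : summable_seq u -> (forall n, u n.*2 = 0) ->
  Sum u = Sum (fun n => u n.*2.+1).
Proof.
move=> cu u0; rewrite Sum_behead//; last exact: (u0 0%N).
rewrite (Sum_even (u := fun n => u n.+1))//.
  rewrite /summable_seq -seriesS0; last exact: (u0 0%N).
  by move/cvg_ex: cu => [l cl]; apply/cvg_ex; exists l; rewrite cvg_shiftS.
by move=> n; rewrite -doubleS.
Qed.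

Lemma summable_even u : summable_seq u -> (forall n, u n.*2.+1 = 0) ->
  summable_seq (fun n => u n.*2).
Proof.
move=> cu u0; rewrite /summable_seq (series_even u0).
apply/cvg_ex; exists (limn (series u)).
exact: (@cvg_comp _ _ _ (fun n => n.*2) (series u) _ _ _ cvg_double cu).
Qed.

Lemma summable_odd u : summable_seq u -> (forall n, u n.*2 = 0) ->
  summable_seq (fun n => u n.*2.+1).
Proof.
move=> cu u0; apply: (@summable_even (fun n => u n.+1)); last first.
  by move=> n; rewrite -doubleS.
rewrite /summable_seq -seriesS0; last exact: (u0 0%N).
by apply/cvg_ex; exists (limn (series u)); rewrite cvg_shiftS.
Qed.

End sums.

Arguments summable_scale {R} k {u} _.


Section termwise.
Context {R : realType}.

(** A quadratic error bound is the form of differentiability that survives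
summation of a series of functions. *)
Lemma quadratic_has_derive (F : R -> R) (x d C : R) :
  (forall h, `|h| <= 1 -> `|F (x + h) - F x - h * d| <= C * h ^+ 2) ->
  has_derive F x d.
Proof.
move=> FC.
have FF : h^-1 *: (F (h *: 1 + x) - F x) @[h --> 0^'] --> d.
  apply/cvgrPdist_le => e e0.
  have eC : 0 < e / (`|C| + 1) by rewrite divr_gt0// ltr_wpDl.
  near=> h.
  have h0 : h != 0 by near: h; exact: nbhs_dnbhs_neq.
  have h1 : `|h| <= 1 by near: h; exact: (dnbhs0_le ltr01).
  have he : `|h| <= e / (`|C| + 1) by near: h; exact: (dnbhs0_le eC).
  have -> : d - h^-1 *: (F (h *: 1 + x) - F x) =
      - (h^-1 * (F (x + h) - F x - h * d)).
    rewrite [h *: 1]mulr1 [h + x]addrC [h^-1 *: _]mulrC.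
    by field.
  rewrite normrN normrM normfV mulrC ler_pdivrMr ?normr_gt0//.
  apply: le_trans (FC h h1) _.
  have -> : h ^+ 2 = `|h| * `|h| by rewrite -normrM -expr2 ger0_norm// sqr_ge0.
  rewrite mulrA ler_wpM2r// (@le_trans _ _ ((`|C| + 1) * `|h|))//.
    rewrite ler_wpM2r// (le_trans (ler_norm C))// lerDl//.
  by rewrite -ler_pdivlMl ?ltr_wpDl// mulrC.
split; last by apply/cvg_lim.
by apply/cvg_ex; exists d.
Unshelve. all: by end_near. Qed.

(** Differentiation under the sum: the second order Taylor errors of the terms
are dominated by a summable sequence, so the error of the sum is quadratic
too. *)
Lemma termwise_has_derive (f df : nat -> R -> R) (x : R) (M : nat -> R) :
  (forall n h, `|h| <= 1 ->
    `|f n (x + h) - f n x - h * df n x| <= M n * h ^+ 2) ->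
  summable_seq M -> (forall y, summable_seq (f^~ y)) -> summable_seq (df^~ x) ->
  has_derive (fun y => Sum (f^~ y)) x (Sum (df^~ x)).
Proof.
move=> fM sM sf sdf; apply: (@quadratic_has_derive _ _ _ (Sum M)) => h h1.
have -> : Sum (f^~ (x + h)) - Sum (f^~ x) - h * Sum (df^~ x) =
    Sum (fun n => f n (x + h) - f n x - h * df n x).
  have s1 := sf (x + h); have s2 := sf x.
  have s3 : summable_seq (fun n => 1 * f n (x + h) + -1 * f n x).
    by apply: summable_add; exact: summable_scale.
  transitivity (Sum (fun n => 1 * (1 * f n (x + h) + -1 * f n x)
                              + (- h) * df n x)).
    by rewrite (Sum_lin _ _ s3 sdf) (Sum_lin _ _ s1 s2); ring.
  by congr Sum; apply/funext => n; ring.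
rewrite [Sum M * _]mulrC -Sum_scale//.
apply: Sum_norm_le; first exact: summable_scale.
by move=> n; rewrite [h ^+ 2 * _]mulrC; exact: fM.
Qed.

(** The derivative is [M]-Lipschitz, so [f z - z f' x] has a derivative bounded
by [M |y - x|] between [x] and [y]. *)
Lemma taylor1_norm_le (f df ddf : R -> R) (M x y : R) :
  (forall z : R, has_derive f z (df z)) ->
  (forall z : R, has_derive df z (ddf z)) ->
  (forall z, `|ddf z| <= M) ->
  `|f y - f x - (y - x) * df x| <= M * (y - x) ^+ 2.
Proof.
move=> f1 f2 fM; have M0 : 0 <= M by apply: le_trans (fM 0).
have lip u v : `|df v - df u| <= M * `|v - u|.
  wlog uv : u v / u <= v => [H|].
    by case: (leP u v) => [|/ltW] uv; [exact: H|rewrite distrC [ `|v - u|]distrC H].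
  by rewrite [ `|v - u|]ger0_norm ?subr_ge0//; apply: derive_norm_le.
have D (z : R) : has_derive (fun z => f z - z * df x) z (df z - df x).
  apply: has_derive_eq.
    by apply: has_derive_add; [exact: f1|deriv].
  by rewrite /=; ring.
have -> : f y - f x - (y - x) * df x = (f y - y * df x) - (f x - x * df x).
  by ring.
case: (leP x y) => [|/ltW] xy.
  have -> : M * (y - x) ^+ 2 = (M * (y - x)) * (y - x) by ring.
  apply: (derive_norm_le xy (fun z _ => D z)) => z /andP[xz zy].
  apply: le_trans (lip _ _) _; rewrite ler_wpM2l// ger0_norm ?subr_ge0//.
  by rewrite lerD2r.
rewrite distrC; have -> : M * (y - x) ^+ 2 = (M * (x - y)) * (x - y) by ring.
apply: (derive_norm_le xy (fun z _ => D z)) => z /andP[yz zx].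
apply: le_trans (lip _ _) _; rewrite ler_wpM2l// distrC ger0_norm ?subr_ge0//.
by rewrite lerD2l lerN2.
Qed.

End termwise.

(** * Entire functions with real coefficients in polar coordinates *)

Section polar.
Context {R : realType}.
Implicit Types (c d : nat -> R) (r rho theta k : R).

(** A power series is represented by its coefficients. Absolute convergence at
all radii makes sums, shifts and derivatives meaningful everywhere. *)
Definition entire c := forall rho, summable_seq (fun n => `|c n| * `|rho| ^+ n).

(** Real and imaginary part of [\sum_n c n * z ^+ n] at [z = r e^(i theta)]. *)
Definition reS c r theta : R := Sum (fun n => c n * r ^+ n * cos (n%:R * theta)).
Definition imS c r theta : R := Sum (fun n => c n * r ^+ n * sin (n%:R * theta)).

Lemma summable_tail (u : nat -> R) : summable_seq u -> summable_seq (fun n => u n.+1).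
Proof.
move=> su; rewrite /summable_seq.
have -> : series (fun n => u n.+1) = (fun n => series u n.+1 - u 0%N).
  apply/funext => n; rewrite /series/= big_nat_recl//=.
  by rewrite addrC addKr.
apply: is_cvgB; last exact: is_cvg_cst.
by move/cvg_ex: su => [l sl]; apply/cvg_ex; exists l; rewrite cvg_shiftS.
Qed.

Lemma entire_dom c d : entire d -> (forall n, `|c n| <= `|d n|) -> entire c.
Proof.
move=> ed cd rho; apply: summable_dom (ed rho) _ => n.
by rewrite normrM normr_id normrX normr_id ler_wpM2r// exprn_ge0.
Qed.

(** The coefficients of [(f z - f 0) / z] and, next, of [f' z]. *)
Definition unshift c n : R := c n.+1.
Definition dcoef c n : R := n.+1%:R * c n.+1.

(** From [n + 1 <= 2 ^ (n + 1)]: the loss is absorbed by doubling the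
radius. *)
Lemma entire_dcoef c : entire c -> entire (dcoef c).
Proof.
move=> ec rho.
apply: summable_dom (summable_tail (ec (2 * (`|rho| + 1)))) _ => n.
have r1 : 0 <= `|rho| + 1 by rewrite addr_ge0.
rewrite [ `|2 * _|]ger0_norm ?mulr_ge0//.
rewrite /dcoef normrM normr_id normrX normr_id normrM [ `|n.+1%:R|]ger0_norm//.
rewrite mulrAC mulrC ler_wpM2l// exprMn.
apply: ler_pM => //; rewrite ?exprn_ge0//.
  by rewrite -natrX ler_nat ltnW// ltn_expl.
apply: (@le_trans _ _ ((`|rho| + 1) ^+ n)).
  by apply: lerXn2r; rewrite ?nnegrE// lerDl.
by apply: ler_weXn2l => //; rewrite lerDr.
Qed.

Lemma entire_unshift c : entire c -> entire (unshift c).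
Proof.
move=> /entire_dcoef ec; apply: entire_dom ec _ => n.
rewrite /unshift /dcoef normrM ger0_norm ?ler_peMl//.
by rewrite ler1n.
Qed.

Lemma entire_summable c r (e : nat -> R) : entire c ->
  (forall n, `|e n| <= 1) -> summable_seq (fun n => c n * r ^+ n * e n).
Proof.
move=> ec e1; apply: summable_dom (ec r) _ => n.
by rewrite !normrM normrX ler_piMr// mulr_ge0.
Qed.

Arguments entire_summable [c] r [e].

Lemma summable_re c r theta : entire c ->
  summable_seq (fun n => c n * r ^+ n * cos (n%:R * theta)).
Proof. by move=> ec; apply: entire_summable => // n; exact: cos_max. Qed.

Lemma summable_im c r theta : entire c ->
  summable_seq (fun n => c n * r ^+ n * sin (n%:R * theta)).
Proof. by move=> ec; apply: entire_summable => // n; exact: sin_max. Qed.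

Lemma reS_lin k c l d r theta : entire c -> entire d ->
  reS (fun n => k * c n + l * d n) r theta = k * reS c r theta + l * reS d r theta.
Proof.
move=> ec ed; rewrite /reS -Sum_lin; [|exact: summable_re..].
by congr Sum; apply/funext => n; ring.
Qed.

Lemma imS_lin k c l d r theta : entire c -> entire d ->
  imS (fun n => k * c n + l * d n) r theta = k * imS c r theta + l * imS d r theta.
Proof.
move=> ec ed; rewrite /imS -Sum_lin; [|exact: summable_im..].
by congr Sum; apply/funext => n; ring.
Qed.

Lemma cosSn n theta :
  cos (n.+1%:R * theta) = cos theta * cos (n%:R * theta) - sin theta * sin (n%:R * theta).
Proof. by rewrite -natr1 mulrDl mul1r cosD; ring. Qed.

Lemma sinSn n theta :
  sin (n.+1%:R * theta) = sin theta * cos (n%:R * theta) + cos theta * sin (n%:R * theta).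
Proof. by rewrite -natr1 mulrDl mul1r sinD; ring. Qed.

(** Multiplication by [z]. *)
Lemma reS_unshift c r theta : entire c -> c 0%N = 0 ->
  reS c r theta =
  r * (cos theta * reS (unshift c) r theta - sin theta * imS (unshift c) r theta).
Proof.
move=> ec c0; have ed := entire_unshift ec.
rewrite /reS Sum_behead; [|exact: summable_re|by rewrite c0 !mul0r].
rewrite mulrBr !mulrA -mulNr.
rewrite -Sum_lin; [|exact: summable_re|exact: summable_im].
by congr Sum; apply/funext => n; rewrite cosSn /unshift exprS; ring.
Qed.

Lemma imS_unshift c r theta : entire c -> c 0%N = 0 ->
  imS c r theta =
  r * (sin theta * reS (unshift c) r theta + cos theta * imS (unshift c) r theta).
Proof.
move=> ec c0; have ed := entire_unshift ec.
rewrite /imS Sum_behead; [|exact: summable_im|by rewrite c0 !mul0r].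
rewrite mulrDr !mulrA.
rewrite -Sum_lin; [|exact: summable_re|exact: summable_im].
by congr Sum; apply/funext => n; rewrite sinSn /unshift exprS; ring.
Qed.

Let pseries_cvg c (e : nat -> R) r : entire c -> (forall n, `|e n| <= 1) ->
  cvgn (pseries (fun n => c n * e n) r).
Proof.
move=> ec e1; have := entire_summable r ec e1.
rewrite /summable_seq /pseries.
by have -> // : (fun n => c n * r ^+ n * e n) = (fun n => c n * e n * r ^+ n);
  apply/funext => n; ring.
Qed.

Arguments pseries_cvg [c e] r.

(** For a fixed angle the real and imaginary parts are real power series in the
radius, with [c n] replaced by [c n * e n]. *)
Let radial_derive c (e : nat -> R) r : entire c -> (forall n, `|e n| <= 1) ->
  has_derive (fun s => Sum (fun n => c n * s ^+ n * e n)) r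
    (Sum (fun n => dcoef c n * r ^+ n * e n.+1)).
Proof.
move=> ec e1.
have ec1 := entire_dcoef ec; have ec2 := entire_dcoef ec1.
have E1 : pseries_diffs (fun n => c n * e n) = (fun n => dcoef c n * e n.+1).
  by apply/funext => n; rewrite /pseries_diffs /dcoef mulrA.
have E2 : pseries_diffs (fun n => dcoef c n * e n.+1) =
    (fun n => dcoef (dcoef c) n * e n.+2).
  by apply/funext => n; rewrite /pseries_diffs {2}/dcoef mulrA.
have := @pseries_snd_diffs R (fun n => c n * e n) (`|r| + 1) r.
rewrite E1 E2 => H.
have {H} := H (pseries_cvg (`|r| + 1) ec e1)
  (pseries_cvg (`|r| + 1) ec1 (fun n => e1 n.+1))
  (pseries_cvg (`|r| + 1) ec2 (fun n => e1 n.+2)).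
have rK : `|r| < `| `|r| + 1 | by rewrite [ltRHS]ger0_norm ?addr_ge0// ltrDl.
move=> /(_ rK).
rewrite /pseries /has_derive /Sum.
have -> : (fun x : R => limn (series (fun i => c i * e i * x ^+ i))) =
   (fun s : R => limn (series (fun n : nat => c n * s ^+ n * e n))).
  by apply/funext => s; congr (limn (series _)); apply/funext => n/=; ring.
have -> // : (fun i => dcoef c i * e i.+1 * r ^+ i) =
   (fun n => dcoef c n * r ^+ n * e n.+1).
by apply/funext => n; ring.
Qed.

(** The radial derivative is the real part of [e^(i theta)] times the complex
derivative, whose coefficients are [dcoef c]. *)
Lemma reS_radial c r theta : entire c ->
  has_derive (reS c ^~ theta) r
    (cos theta * reS (dcoef c) r theta - sin theta * imS (dcoef c) r theta).
Proof.
move=> ec; have ed := entire_dcoef ec; apply: has_derive_eq.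
  by apply: (radial_derive (e := fun n => cos (n%:R * theta))) => // n; exact: cos_max.
rewrite -mulNr -Sum_lin; [|exact: summable_re|exact: summable_im].
by congr Sum; apply/funext => n; rewrite cosSn; ring.
Qed.

Lemma imS_radial c r theta : entire c ->
  has_derive (imS c ^~ theta) r
    (sin theta * reS (dcoef c) r theta + cos theta * imS (dcoef c) r theta).
Proof.
move=> ec; have ed := entire_dcoef ec; apply: has_derive_eq.
  by apply: (radial_derive (e := fun n => sin (n%:R * theta))) => // n; exact: sin_max.
rewrite -Sum_lin; [|exact: summable_re|exact: summable_im].
by congr Sum; apply/funext => n; rewrite sinSn; ring.
Qed.

(** The coefficients of [z f' z], which governs the derivative in the angle. *)
Definition euler c n : R := n%:R * c n.

Lemma entire_euler c : entire c -> entire (euler c).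
Proof.
move=> /entire_dcoef ec rho; apply: summable_behead.
  by rewrite /euler mul0r normr0 mul0r.
apply: summable_dom (summable_scale `|rho| (ec rho)) _ => n.
by rewrite !normrM !normr_id normrX normr_id exprS mulrCA.
Qed.

(** In the angle each term is [c n * r ^ n * e (n t)], whose second derivative
is bounded by [n ^ 2 |c n| r ^ n]. *)
Let angular_derive c r (e e1 e2 : R -> R) theta : entire c ->
  (forall t, has_derive e t (e1 t)) -> (forall t, has_derive e1 t (e2 t)) ->
  (forall t, `|e t| <= 1) -> (forall t, `|e1 t| <= 1) -> (forall t, `|e2 t| <= 1) ->
  has_derive (fun t => Sum (fun n => c n * r ^+ n * e (n%:R * t))) theta
    (Sum (fun n => euler c n * r ^+ n * e1 (n%:R * theta))).
Proof.
move=> ec d1 d2 b0 b1 b2; have eu := entire_euler ec; have eu2 := entire_euler eu.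
have -> : (fun n => euler c n * r ^+ n * e1 (n%:R * theta)) =
   (fun n => (fun n t => c n * r ^+ n * (n%:R * e1 (n%:R * t))) n theta).
  by apply/funext => n; rewrite /euler; ring.
apply: (@termwise_has_derive _ (fun n t => c n * r ^+ n * e (n%:R * t))
  (fun n t => c n * r ^+ n * (n%:R * e1 (n%:R * t))) theta
  (fun n => `|euler (euler c) n| * `|r| ^+ n)).
- move=> n h _.
  have -> : c n * r ^+ n * e (n%:R * (theta + h)) - c n * r ^+ n * e (n%:R * theta) -
      h * (c n * r ^+ n * (n%:R * e1 (n%:R * theta))) =
    c n * r ^+ n * (e (n%:R * theta + n%:R * h) - e (n%:R * theta) -
      (n%:R * theta + n%:R * h - n%:R * theta) * e1 (n%:R * theta)).
    by rewrite mulrDr; ring.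
  rewrite normrM.
  have := taylor1_norm_le (n%:R * theta) (n%:R * theta + n%:R * h) d1 d2 b2.
  move=> /(ler_wpM2l (normr_ge0 (c n * r ^+ n))) /le_trans; apply.
  rewrite /euler !normrM normrX [ `|n%:R|]ger0_norm//.
  by rewrite le_eqVlt; apply/orP; left; apply/eqP; ring.
- exact: eu2.
- by move=> t; apply: entire_summable.
- have := entire_summable r eu (fun n => b1 (n%:R * theta)).
  congr summable_seq; apply/funext => n; rewrite /euler; ring.
Qed.

Lemma reS_angular c r theta : entire c ->
  has_derive (reS c r) theta
    (- r * (sin theta * reS (dcoef c) r theta + cos theta * imS (dcoef c) r theta)).
Proof.
move=> ec; have eu := entire_euler ec; apply: has_derive_eq.
  apply: (@angular_derive c r cos (fun t => - sin t)
    (fun t => - cos t)) => // t; rewrite ?normrN ?cos_max ?sin_max//.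
  - exact: is_derive_cos.
  - by apply: has_derive_opp; exact: is_derive_sin.
have -> : - r * (sin theta * reS (dcoef c) r theta + cos theta * imS (dcoef c) r theta) =
    - imS (euler c) r theta.
  by rewrite mulNr (imS_unshift (c := euler c))// /euler mul0r.
rewrite -mulN1r -Sum_scale; last exact: summable_im.
by congr Sum; apply/funext => n; ring.
Qed.

Lemma imS_angular c r theta : entire c ->
  has_derive (imS c r) theta
    (r * (cos theta * reS (dcoef c) r theta - sin theta * imS (dcoef c) r theta)).
Proof.
move=> ec; have eu := entire_euler ec; apply: has_derive_eq.
  apply: (@angular_derive c r sin cos
    (fun t => - sin t)) => // t; rewrite ?normrN ?cos_max ?sin_max//.
  - exact: is_derive_sin.
  - exact: is_derive_cos.
by rewrite (_ : r * _ = reS (euler c) r theta)// (reS_unshift (c := euler c))// /euler mul0r.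
Qed.

(** A bound for the series on the whole circle of radius [r], uniform in the
angle. *)
Definition majorant c r : R := Sum (fun n => `|c n| * `|r| ^+ n).

Lemma reS_norm_le c r theta : entire c -> `|reS c r theta| <= majorant c r.
Proof.
move=> ec; apply: Sum_norm_le => // n.
by rewrite !normrM normrX ler_piMr ?cos_max// mulr_ge0.
Qed.

Lemma imS_norm_le c r theta : entire c -> `|imS c r theta| <= majorant c r.
Proof.
move=> ec; apply: Sum_norm_le => // n.
by rewrite !normrM normrX ler_piMr ?sin_max// mulr_ge0.
Qed.

End polar.

(** * The Bessel system in the complex plane *)

Section system.
Context {R : realType}.
Variable nu : R.
Implicit Types r theta : R.
Hypothesis nu0 : 0 <= nu.

(** With [I_nu = (z / 2) ^ nu / Gamma (nu + 1) * P] and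
[I_(nu+1) = (z / 2) ^ nu / Gamma (nu + 1) * Q], the function [P] is even and
[Q] is odd, and [P' = Q], [Q' = P - (2 nu + 1) Q / z]. Reading these equations
on coefficients gives a single sequence whose even terms belong to [P] and
whose odd terms belong to [Q]. *)
Fixpoint tcoef (n : nat) : R :=
  if n is m.+1 then tcoef m / (n%:R + (if odd n then 2 * nu + 1 else 0)) else 1.

Definition Pcoef n : R := if odd n then 0 else tcoef n.
Definition Qcoef n : R := if odd n then tcoef n else 0.

Lemma tcoef_den_gt0 n : 0 < n.+1%:R + (if odd n.+1 then 2 * nu + 1 else 0).
Proof. by case: ifP => _; rewrite ltr_wpDr// addr_ge0// mulr_ge0. Qed.

Lemma tcoef_gt0 n : 0 < tcoef n.
Proof. by elim: n => //= n IH; rewrite divr_gt0//; exact: tcoef_den_gt0. Qed.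

Lemma tcoef_le n : tcoef n <= n`!%:R^-1.
Proof.
elim: n => [|n IH]; first by rewrite fact0 invr1.
rewrite [tcoef _]/= factS natrM invfM mulrC ler_pM//.
- by rewrite invr_ge0 ltW// tcoef_den_gt0.
- by rewrite ltW// tcoef_gt0.
- by rewrite lef_pV2 ?posrE ?tcoef_den_gt0// lerDl; case: ifP => // _; rewrite addr_ge0 ?mulr_ge0.
Qed.

Lemma entire_invfact : entire (fun n => (n`!%:R)^-1 : R).
Proof.
move=> rho; have := is_cvg_series_exp_coeff `|rho|.
rewrite /summable_seq.
have -> // : exp_coeff `|rho| = (fun n => `|n`!%:R^-1| * `|rho| ^+ n).
by apply/funext => n; rewrite /exp_coeff/= [ `|_^-1|]ger0_norm ?invr_ge0// mulrC.
Qed.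

Lemma entire_tcoef : entire tcoef.
Proof.
apply: entire_dom entire_invfact _ => n.
rewrite !ger0_norm; first exact: tcoef_le.
- by rewrite invr_ge0.
- by rewrite ltW// tcoef_gt0.
Qed.

Lemma entire_P : entire Pcoef.
Proof.
apply: entire_dom entire_tcoef _ => n; rewrite /Pcoef.
by case: ifP => // _; rewrite normr0.
Qed.

Lemma entire_Q : entire Qcoef.
Proof.
apply: entire_dom entire_tcoef _ => n; rewrite /Qcoef.
by case: ifP => // _; rewrite normr0.
Qed.

(** The equations [P' = Q] and, next, [Q' = P - (2 nu + 1) Q / z]. *)
Lemma dcoef_P : dcoef Pcoef = Qcoef.
Proof.
apply/funext => n; rewrite /dcoef /Pcoef /Qcoef/=.
case: ifPn => /= on; first by rewrite (negbTE on) mulr0.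
by rewrite (negPn on) addr0 mulrC divfK.
Qed.

Lemma dcoef_Q :
  dcoef Qcoef = (fun n => 1 * Pcoef n + - (2 * nu + 1) * unshift Qcoef n).
Proof.
apply/funext => n; have := tcoef_den_gt0 n.
rewrite /dcoef /Pcoef /Qcoef /unshift/=; case: ifPn => /= on d0.
  rewrite (negbTE on); move/lt0r_neq0: d0 => d0.
  by field; rewrite nat1r.
by rewrite (negPn on) !mulr0 addr0.
Qed.

Local Notation p1 := (reS Pcoef).
Local Notation p2 := (imS Pcoef).
Local Notation q1 := (reS Qcoef).
Local Notation q2 := (imS Qcoef).

Let a := nu + 1 / 2.

(** Real and imaginary part of [e^(- i theta) * P], that is of [r P / z]. *)
Definition rotP1 r theta : R := cos theta * p1 r theta + sin theta * p2 r theta.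
Definition rotP2 r theta : R := cos theta * p2 r theta - sin theta * p1 r theta.

Lemma P1_rot r theta :
  p1 r theta = cos theta * rotP1 r theta - sin theta * rotP2 r theta.
Proof.
by rewrite -[LHS]mul1r -(cos2Dsin2 theta) /rotP1 /rotP2; ring.
Qed.

Lemma P2_rot r theta :
  p2 r theta = sin theta * rotP1 r theta + cos theta * rotP2 r theta.
Proof.
by rewrite -[LHS]mul1r -(cos2Dsin2 theta) /rotP1 /rotP2; ring.
Qed.

Lemma P1_radial r theta :
  has_derive (p1^~ theta) r (cos theta * q1 r theta - sin theta * q2 r theta).
Proof. by have := @reS_radial R _ r theta entire_P; rewrite dcoef_P. Qed.

Lemma P2_radial r theta :
  has_derive (p2^~ theta) r (sin theta * q1 r theta + cos theta * q2 r theta).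
Proof. by have := @imS_radial R _ r theta entire_P; rewrite dcoef_P. Qed.

Lemma reS_dQ r theta : r != 0 ->
  cos theta * reS (dcoef Qcoef) r theta - sin theta * imS (dcoef Qcoef) r theta =
  cos theta * p1 r theta - sin theta * p2 r theta - (2 * nu + 1) * q1 r theta / r.
Proof.
move=> r0; have ed := entire_unshift entire_Q; have eP := entire_P.
rewrite dcoef_Q reS_lin// imS_lin// [q1 r theta]reS_unshift//; last exact: entire_Q.
by field.
Qed.

Lemma imS_dQ r theta : r != 0 ->
  sin theta * reS (dcoef Qcoef) r theta + cos theta * imS (dcoef Qcoef) r theta =
  sin theta * p1 r theta + cos theta * p2 r theta - (2 * nu + 1) * q2 r theta / r.
Proof.
move=> r0; have ed := entire_unshift entire_Q; have eP := entire_P.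
rewrite dcoef_Q reS_lin// imS_lin// [q2 r theta]imS_unshift//; last exact: entire_Q.
by field.
Qed.

Lemma Q1_radial r theta : r != 0 -> has_derive (q1^~ theta) r
  (cos theta * p1 r theta - sin theta * p2 r theta - (2 * nu + 1) * q1 r theta / r).
Proof.
by move=> r0; apply: has_derive_eq (reS_radial _ _ entire_Q) _; exact: reS_dQ.
Qed.

Lemma Q2_radial r theta : r != 0 -> has_derive (q2^~ theta) r
  (sin theta * p1 r theta + cos theta * p2 r theta - (2 * nu + 1) * q2 r theta / r).
Proof.
by move=> r0; apply: has_derive_eq (imS_radial _ _ entire_Q) _; exact: imS_dQ.
Qed.

Lemma P1_angular r theta : has_derive (p1 r) theta
  (- r * (sin theta * q1 r theta + cos theta * q2 r theta)).
Proof. by have := @reS_angular R _ r theta entire_P; rewrite dcoef_P. Qed.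

Lemma P2_angular r theta : has_derive (p2 r) theta
  (r * (cos theta * q1 r theta - sin theta * q2 r theta)).
Proof. by have := @imS_angular R _ r theta entire_P; rewrite dcoef_P. Qed.

Lemma Q1_angular r theta : r != 0 -> has_derive (q1 r) theta
  (- r * (sin theta * p1 r theta + cos theta * p2 r theta) + (2 * nu + 1) * q2 r theta).
Proof.
move=> r0; apply: has_derive_eq (reS_angular _ _ entire_Q) _.
by rewrite imS_dQ//; field.
Qed.

Lemma Q2_angular r theta : r != 0 -> has_derive (q2 r) theta
  (r * (cos theta * p1 r theta - sin theta * p2 r theta) - (2 * nu + 1) * q1 r theta).
Proof.
move=> r0; apply: has_derive_eq (imS_angular _ _ entire_Q) _.
by rewrite reS_dQ//; field.
Qed.

Lemma rotP1_radial r theta : has_derive (rotP1^~ theta) r (q1 r theta).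
Proof.
apply: has_derive_eq.
  apply: has_derive_add; apply: has_derive_mul;
    [exact: has_derive_cst|exact: P1_radial|exact: has_derive_cst|exact: P2_radial].
rewrite -[RHS]mul1r -(cos2Dsin2 theta); ring.
Qed.

Lemma rotP2_radial r theta : has_derive (rotP2^~ theta) r (q2 r theta).
Proof.
apply: has_derive_eq.
  apply: has_derive_add; [|apply: has_derive_opp]; apply: has_derive_mul;
    [exact: has_derive_cst|exact: P2_radial|exact: has_derive_cst|exact: P1_radial].
rewrite -[RHS]mul1r -(cos2Dsin2 theta); ring.
Qed.

Lemma rotP1_angular r theta :
  has_derive (rotP1 r) theta (rotP2 r theta - r * q2 r theta).
Proof.
apply: has_derive_eq.
  apply: has_derive_add; apply: has_derive_mul;
    [exact: is_derive_cos|exact: P1_angular|exact: is_derive_sin|exact: P2_angular].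
rewrite -[q2 r theta in RHS]mul1r -(cos2Dsin2 theta) /rotP2; ring.
Qed.

Lemma rotP2_angular r theta :
  has_derive (rotP2 r) theta (- rotP1 r theta + r * q1 r theta).
Proof.
apply: has_derive_eq.
  apply: has_derive_add; [|apply: has_derive_opp]; apply: has_derive_mul;
    [exact: is_derive_cos|exact: P2_angular|exact: is_derive_sin|exact: P1_angular].
rewrite -[q1 r theta in RHS]mul1r -(cos2Dsin2 theta) /rotP1; ring.
Qed.

(** Let [a = nu + 1/2] and [g = z ^ a exp (- z) P]. Then [X] and [Y] are
[g' + 2 g] and [g'] divided by [z ^ a exp (- z)], and [weight] is the squared
modulus of that factor. Bessel's equation [g'' + 2 g' = c0 g / z ^ 2] says that
[g' + 2 g] has derivative [c0 g / z ^ 2], and that [g'] is damped at rate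
[2] up to the same term. *)
Definition X1 r theta := p1 r theta + q1 r theta + a / r * rotP1 r theta.
Definition X2 r theta := p2 r theta + q2 r theta + a / r * rotP2 r theta.
Definition Y1 r theta := q1 r theta - p1 r theta + a / r * rotP1 r theta.
Definition Y2 r theta := q2 r theta - p2 r theta + a / r * rotP2 r theta.

Definition weight r theta : R := r `^ (2 * nu + 1) * expR (- 2 * cos theta * r).
Definition energyX r theta := weight r theta * (X1 r theta ^+ 2 + X2 r theta ^+ 2).
Definition energyY r theta := weight r theta * (Y1 r theta ^+ 2 + Y2 r theta ^+ 2).

Let c0 := nu ^+ 2 - 1 / 4.

Ltac use_system := repeat (match goal with
  | |- has_derive (fun r => reS Pcoef r _) _ _ => apply: P1_radial
  | |- has_derive (fun r => imS Pcoef r _) _ _ => apply: P2_radial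
  | |- has_derive (fun r => reS Qcoef r _) _ _ => apply: Q1_radial
  | |- has_derive (fun r => imS Qcoef r _) _ _ => apply: Q2_radial
  | |- has_derive (fun r => rotP1 r _) _ _ => apply: rotP1_radial
  | |- has_derive (fun r => rotP2 r _) _ _ => apply: rotP2_radial
  | |- has_derive (reS Pcoef _) _ _ => apply: P1_angular
  | |- has_derive (imS Pcoef _) _ _ => apply: P2_angular
  | |- has_derive (reS Qcoef _) _ _ => apply: Q1_angular
  | |- has_derive (imS Qcoef _) _ _ => apply: Q2_angular
  | |- has_derive (rotP1 _) _ _ => apply: rotP1_angular
  | |- has_derive (rotP2 _) _ _ => apply: rotP2_angular
  | _ => progress deriv
  end).

(** From [(g' + 2 g)' = c0 g / z ^ 2]; the angular derivative below has the
extra factor [r] of the length of an arc. *)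
Lemma energyX_radial r theta : 0 < r -> has_derive (energyX^~ theta) r
  (2 * c0 / r ^+ 2 * weight r theta *
   (X1 r theta * rotP1 r theta + X2 r theta * rotP2 r theta)).
Proof.
move=> r0; have rn0 : r != 0 by rewrite gt_eqF.
rewrite /energyX /X1 /X2 /weight; apply: has_derive_eq; first by use_system.
by rewrite powR_sub1// !P1_rot !P2_rot /a /c0 /=; field.
Qed.

(** From [g'' = - 2 g' + c0 g / z ^ 2]; the last term is the damping, which has
the right sign in the half plane [Re z >= 0]. *)
Lemma energyY_radial r theta : 0 < r -> has_derive (energyY^~ theta) r
  (2 * c0 / r ^+ 2 * weight r theta *
   (Y1 r theta * rotP1 r theta + Y2 r theta * rotP2 r theta)
   - 4 * cos theta * energyY r theta).
Proof.
move=> r0; have rn0 : r != 0 by rewrite gt_eqF.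
rewrite /energyY /Y1 /Y2 /weight; apply: has_derive_eq; first by use_system.
by rewrite powR_sub1// !P1_rot !P2_rot /a /c0 /=; field.
Qed.

Lemma energyX_angular r theta : 0 < r -> has_derive (energyX r) theta
  (2 * c0 / r * weight r theta *
   (X2 r theta * rotP1 r theta - X1 r theta * rotP2 r theta)).
Proof.
move=> r0; have rn0 : r != 0 by rewrite gt_eqF.
rewrite /energyX /X1 /X2 /weight; apply: has_derive_eq.
  by use_system.
by rewrite !P1_rot !P2_rot /a /c0 /=; field.
Qed.

Definition energy r theta := energyX r theta + energyY r theta.

Lemma weight_gt0 r theta : 0 < r -> 0 < weight r theta.
Proof. by move=> r0; rewrite mulr_gt0 ?powR_gt0 ?expR_gt0. Qed.

Lemma energyX_ge0 r theta : 0 < r -> 0 <= energyX r theta.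
Proof.
by move=> r0; rewrite mulr_ge0 ?addr_ge0 ?sqr_ge0// ltW// weight_gt0.
Qed.

Lemma energyY_ge0 r theta : 0 < r -> 0 <= energyY r theta.
Proof.
by move=> r0; rewrite mulr_ge0 ?addr_ge0 ?sqr_ge0// ltW// weight_gt0.
Qed.

Lemma energyE r theta : energy r theta = weight r theta *
  (X1 r theta ^+ 2 + X2 r theta ^+ 2 + Y1 r theta ^+ 2 + Y2 r theta ^+ 2).
Proof. by rewrite /energy /energyX /energyY; ring. Qed.

(** Since [X - Y = 2 P], the vector [rotP] has norm [|X - Y| / 2]. *)
Lemma rotP_norm r theta : 4 * (rotP1 r theta ^+ 2 + rotP2 r theta ^+ 2) =
  (X1 r theta - Y1 r theta) ^+ 2 + (X2 r theta - Y2 r theta) ^+ 2.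
Proof.
have -> : X1 r theta - Y1 r theta = 2 * p1 r theta by rewrite /X1 /Y1; ring.
have -> : X2 r theta - Y2 r theta = 2 * p2 r theta by rewrite /X2 /Y2; ring.
rewrite -[LHS]mul1r -{1}(cos2Dsin2 theta) P1_rot P2_rot; ring.
Qed.

(** When [4 |p| ^ 2 = |x - y| ^ 2], the inner products of [p] with [x + y], with
[x] and with [x] rotated by a right angle are controlled by
[|x| ^ 2 + |y| ^ 2]. Each bound is a combination of squares. *)
Let dot_le (x1 x2 y1 y2 u v : R) :
  4 * (u ^+ 2 + v ^+ 2) = (x1 - y1) ^+ 2 + (x2 - y2) ^+ 2 ->
  [/\ `|(x1 + y1) * u + (x2 + y2) * v| <= (x1 ^+ 2 + x2 ^+ 2 + y1 ^+ 2 + y2 ^+ 2) / 2,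
     `|x1 * u + x2 * v| <= x1 ^+ 2 + x2 ^+ 2 + y1 ^+ 2 + y2 ^+ 2 &
     `|x2 * u - x1 * v| <= x1 ^+ 2 + x2 ^+ 2 + y1 ^+ 2 + y2 ^+ 2].
Proof.
move=> uv.
have S z : 0 <= z ^+ 2 :> R by exact: sqr_ge0.
have := (S (x1 + y1 + 2 * u), S (x2 + y2 + 2 * v),
         S (x1 + y1 - 2 * u), S (x2 + y2 - 2 * v)).
have := (S (x1 + u), S (x2 + v), S (x1 - u), S (x2 - v)).
have := (S (x2 + u), S (x1 + v), S (x2 - u), S (x1 - v)).
have := (S (x1 + y1), S (x2 + y2), S x1, S x2, S y1, S y2).
move=> [[[[[h1 h2] h3] h4] h5] h6] [[[k1 k2] k3] k4] [[[l1 l2] l3] l4]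
  [[[m1 m2] m3] m4].
by split; rewrite ler_norml; apply/andP; split; lra.
Qed.

Let dots r theta := dot_le (rotP_norm r theta).

(** The damping is dropped, and the remaining terms are at most
[|c0| / r ^ 2] times the energy itself: the hypothesis of Gronwall's
inequality, with an integrable rate. *)
Lemma energy_radial r theta : 0 < r -> 0 <= cos theta ->
  exists2 d, has_derive (energy^~ theta) r d & d <= `|c0| / r ^+ 2 * energy r theta.
Proof.
move=> r0 c_ge0.
have /has_derive_add/(_ (energyY_radial theta r0)) E := energyX_radial theta r0.
exists (2 * c0 / r ^+ 2 * weight r theta *
   (X1 r theta * rotP1 r theta + X2 r theta * rotP2 r theta) +
   (2 * c0 / r ^+ 2 * weight r theta *
   (Y1 r theta * rotP1 r theta + Y2 r theta * rotP2 r theta)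
   - 4 * cos theta * energyY r theta)); first exact: E.
set T := (X1 r theta + Y1 r theta) * rotP1 r theta +
         (X2 r theta + Y2 r theta) * rotP2 r theta.
have -> : 2 * c0 / r ^+ 2 * weight r theta *
   (X1 r theta * rotP1 r theta + X2 r theta * rotP2 r theta) +
   (2 * c0 / r ^+ 2 * weight r theta *
   (Y1 r theta * rotP1 r theta + Y2 r theta * rotP2 r theta)
   - 4 * cos theta * energyY r theta) =
   2 * weight r theta / r ^+ 2 * (c0 * T) - 4 * cos theta * energyY r theta.
  by rewrite /T; ring.
rewrite lerBlDr; apply: (@le_trans _ _ (`|c0| / r ^+ 2 * energy r theta)); last first.
  by rewrite lerDl mulr_ge0 ?energyY_ge0// mulr_ge0.
have [dT _ _] := dots r theta.
have cT : c0 * T <= `|c0| * ((X1 r theta ^+ 2 + X2 r theta ^+ 2 +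
    Y1 r theta ^+ 2 + Y2 r theta ^+ 2) / 2).
  by apply: le_trans (ler_norm _) _; rewrite normrM ler_wpM2l.
rewrite energyE.
have w0 : 0 <= 2 * weight r theta / r ^+ 2.
  by rewrite divr_ge0 ?sqr_ge0// mulr_ge0// ltW// weight_gt0.
apply: le_trans (ler_wpM2l w0 cT) _.
by rewrite le_eqVlt; apply/orP; left; apply/eqP; field; rewrite gt_eqF.
Qed.

Lemma energyX_radial_le r theta : 0 < r ->
  `|2 * c0 / r ^+ 2 * weight r theta *
   (X1 r theta * rotP1 r theta + X2 r theta * rotP2 r theta)| <=
  2 * `|c0| / r ^+ 2 * energy r theta.
Proof.
move=> r0; have [_ dT _] := dots r theta.
rewrite energyE normrM [leRHS]mulrA; apply: ler_pM => //.
rewrite normrM (gtr0_norm (weight_gt0 theta r0)) !normrM normfV [ `|r ^+ 2|]ger0_norm ?sqr_ge0//.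
by rewrite [ `|2|]ger0_norm.
Qed.

Lemma energyX_angular_le r theta : 0 < r ->
  `|2 * c0 / r * weight r theta *
   (X2 r theta * rotP1 r theta - X1 r theta * rotP2 r theta)| <=
  2 * `|c0| / r * energy r theta.
Proof.
move=> r0; have [_ _ dT] := dots r theta.
rewrite energyE normrM [leRHS]mulrA; apply: ler_pM => //.
rewrite normrM (gtr0_norm (weight_gt0 theta r0)) !normrM normfV [ `|r|]gtr0_norm//.
by rewrite [ `|2|]ger0_norm.
Qed.

(** Gronwall's inequality: [energy * exp (|c0| / r)] is nonincreasing in
[r]. *)
Lemma energy_le_one r theta : 1 <= r -> 0 <= cos theta ->
  energy r theta <= energy 1 theta * expR `|c0|.
Proof.
move=> r1 ct.
pose f s := energy s theta * expR (`|c0| / s).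
have pos (s : R) : 1 <= s -> 0 < s by apply: lt_le_trans.
have D s : 1 <= s -> exists2 d, has_derive f s d & d <= 0.
  move=> s1; have s0 : 0 < s := pos s s1; have sn0 : s != 0 by rewrite gt_eqF.
  have [d Ed dle] := energy_radial s0 ct.
  eexists.
    rewrite /f; apply: has_derive_mul; first exact: Ed.
    by deriv.
  rewrite /=.
  have -> : energy s theta *
    (expR (`|c0| / s) * (`|c0| * (- s ^- 2 * 1) + s^-1 * 0)) +
    expR (`|c0| / s) * d = expR (`|c0| / s) * (d - `|c0| / s ^+ 2 * energy s theta).
    by field.
  by rewrite pmulr_rle0 ?expR_gt0// subr_le0.
pose df s := if pselect (1 <= s) is left H then projT1 (cid2 (D s H)) else 0.
have : f r <= f 1.
  apply: (@derive_le0_ge _ _ df) => // s /andP[s1 _]; rewrite /df;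
    case: pselect => // H; by case: cid2.
rewrite /f divr1; apply: le_trans.
rewrite ler_peMr//; first by rewrite addr_ge0 ?energyX_ge0 ?energyY_ge0 ?pos.
by rewrite -expR0 ler_expR divr_ge0// ltW// pos.
Qed.

(** On the unit circle the energy is bounded by the values of the majorants, and
outside it is controlled by its value there. *)
Lemma energy_bounded : exists2 C : R, 0 <= C &
  forall r theta, 1 <= r -> 0 <= cos theta -> energy r theta <= C.
Proof.
(* [m] bounds the four functions [X1], [X2], [Y1] and [Y2] at radius [1]; the
   weight there is at most [1] *)
pose m := majorant Pcoef 1 + majorant Qcoef 1 + a * (2 * majorant Pcoef 1).
have bP1 theta : `|p1 1 theta| <= majorant Pcoef 1 by apply/reS_norm_le/entire_P.
have bP2 theta : `|p2 1 theta| <= majorant Pcoef 1 by apply/imS_norm_le/entire_P.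
have bQ1 theta : `|q1 1 theta| <= majorant Qcoef 1 by apply/reS_norm_le/entire_Q.
have bQ2 theta : `|q2 1 theta| <= majorant Qcoef 1 by apply/imS_norm_le/entire_Q.
have P0 : 0 <= majorant Pcoef 1 by apply: le_trans (bP1 0).
have a0 : 0 <= a by rewrite addr_ge0.
have br1 theta : `|rotP1 1 theta| <= 2 * majorant Pcoef 1.
  rewrite /rotP1; apply: le_trans (ler_normD _ _) _; rewrite !normrM.
  rewrite (_ : 2 * _ = 1 * majorant Pcoef 1 + 1 * majorant Pcoef 1); last by ring.
  by apply: lerD; apply: ler_pM => //; rewrite ?cos_max ?sin_max.
have br2 theta : `|rotP2 1 theta| <= 2 * majorant Pcoef 1.
  rewrite /rotP2; apply: le_trans (ler_normB _ _) _; rewrite !normrM.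
  rewrite (_ : 2 * _ = 1 * majorant Pcoef 1 + 1 * majorant Pcoef 1); last by ring.
  by apply: lerD; apply: ler_pM => //; rewrite ?cos_max ?sin_max.
have sq x y : `|x| <= y -> x ^+ 2 <= y ^+ 2 :> R.
  move=> xy; rewrite -[x ^+ 2]ger0_norm ?sqr_ge0// normrX lerXn2r// nnegrE//.
  exact: le_trans xy.
have tri x y z k u v w : `|x| <= u -> `|y| <= v -> `|z| <= w -> 0 <= k ->
   `|x + y + k / 1 * z| <= u + v + k * w :> R.
  move=> xu yv zw k0; rewrite divr1.
  apply: le_trans (ler_normD _ _) _; apply: lerD.
    by apply: le_trans (ler_normD _ _) _; apply: lerD.
  by rewrite normrM ger0_norm// ler_wpM2l.
exists (4 * m ^+ 2 * expR `|c0|).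
  by rewrite mulr_ge0 ?expR_ge0// mulr_ge0// sqr_ge0.
move=> r theta r1 ct; apply: le_trans (energy_le_one r1 ct) _.
rewrite ler_wpM2r ?expR_ge0// energyE.
have h1 : X1 1 theta ^+ 2 <= m ^+ 2 by apply/sq/tri.
have h2 : X2 1 theta ^+ 2 <= m ^+ 2 by apply/sq/tri.
have h3 : Y1 1 theta ^+ 2 <= m ^+ 2.
  by apply: sq; rewrite /Y1 [_ - _]addrC; apply: tri; rewrite ?normrN.
have h4 : Y2 1 theta ^+ 2 <= m ^+ 2.
  by apply: sq; rewrite /Y2 [_ - _]addrC; apply: tri; rewrite ?normrN.
have w0 := weight_gt0 theta (@ltr01 R).
have w1 : weight 1 theta <= 1.
  rewrite /weight powR1 mul1r mulr1 -expR0 ler_expR mulNr oppr_le0.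
  by rewrite mulr_ge0.
rewrite -[4 * _]mul1r; apply: ler_pM => //; first exact: ltW.
- by rewrite !addr_ge0 ?sqr_ge0.
- by lra.
Qed.

(** The angular derivative is [O (1 / r)] on the quarter circle of radius
[r]. *)
Lemma energyX_arc : exists2 C : R, 0 <= C & forall r, 1 <= r ->
  `|energyX r (pi / 2) - energyX r 0| <= C / r.
Proof.
have [C C0 EC] := energy_bounded.
exists (2 * `|c0| * C * (pi / 2)).
  by rewrite !mulr_ge0// ?divr_ge0// pi_ge0.
move=> r r1; have r0 : 0 < r by apply: lt_le_trans r1.
have pi2 : 0 <= pi / 2 :> R by rewrite divr_ge0// pi_ge0.
rewrite (_ : _ / r = 2 * `|c0| / r * C * (pi / 2 - 0)); last first.
  by field; rewrite gt_eqF.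
apply: (derive_norm_le pi2) => theta /andP[t0 tpi].
  exact: energyX_angular.
apply: le_trans (energyX_angular_le _ r0) _.
have k0 : 0 <= 2 * `|c0| / r by rewrite divr_ge0 ?mulr_ge0// ltW.
apply: (ler_wpM2l k0); apply: EC => //; apply: cos_ge0_pihalf; rewrite tpi andbT.
by rewrite (le_trans _ t0)// oppr_le0.
Qed.

(** The radial derivative is at most [K / r ^ 2], so
[energyX + K / r] is nonincreasing, and it is nonnegative. *)
Lemma energyX_cvg : cvg (energyX r 0 @[r --> +oo]).
Proof.
have [C C0 EC] := energy_bounded.
pose K := 2 * `|c0| * C.
have K0 : 0 <= K by rewrite !mulr_ge0.
(* the maximum with [1] makes [f] monotone on the whole line *)
pose f r := - (energyX (Num.max r 1) 0 + K / Num.max r 1).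
have max1 r : 1 <= Num.max r 1 by rewrite le_max lexx orbT.
have nd : nondecreasing_fun f.
  move=> r s rs; rewrite lerN2.
  have : Num.max r 1 <= Num.max s 1 by rewrite ge_max !le_max rs lexx orbT.
  move: (Num.max r 1) (Num.max s 1) (max1 r) (max1 s) => {rs}r' {}s' r1 s1 rs.
  pose df t := (2 * c0 / t ^+ 2 * weight t 0 *
   (X1 t 0 * rotP1 t 0 + X2 t 0 * rotP2 t 0)) - K / t ^+ 2.
  apply: (@derive_le0_ge _ (fun t => energyX t 0 + K / t) df) => // t /andP[rt _].
    have t0 : 0 < t by rewrite (lt_le_trans _ rt)// (lt_le_trans _ r1).
    apply: has_derive_eq.
      apply: has_derive_add; first exact: energyX_radial.
      by deriv; rewrite gt_eqF.
    by rewrite /df /=; field; rewrite gt_eqF.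
  have t0 : 0 < t by rewrite (lt_le_trans _ rt)// (lt_le_trans _ r1).
  rewrite subr_le0; apply: le_trans (ler_norm _) _.
  apply: le_trans (energyX_radial_le _ t0) _.
  rewrite /K (_ : _ * C / _ = 2 * `|c0| / t ^+ 2 * C); last by field; rewrite gt_eqF.
  have k0 : 0 <= 2 * `|c0| / t ^+ 2 by apply: divr_ge0; [exact: mulr_ge0|exact: sqr_ge0].
  by apply: (ler_wpM2l k0); apply: EC; rewrite ?cos0// (le_trans r1).
have ub : has_ubound (range f).
  exists 0 => _ [r _ <-]; rewrite oppr_le0 addr_ge0//.
    by rewrite energyX_ge0// (lt_le_trans _ (max1 r)).
  by rewrite divr_ge0// (le_trans _ (max1 r)).
have cf := nondecreasing_cvgr nd ub.
have cK := cvg_div_pinfty K.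
apply/cvg_ex; exists (- sup (range f) - 0).
have H : (fun r => - f r - K / r) r @[r --> +oo] --> - sup (range f) - 0.
  by apply: cvgB => //; exact: cvgN.
apply: cvg_trans H; apply: near_eq_cvg; near=> r.
have r1 : 1 <= r by near: r; apply: nbhs_pinfty_ge; exact: num_real.
by rewrite /f opprK (max_idPl r1) addrK.
Unshelve. all: by end_near. Qed.

End system.

(** * The Gamma function *)

Section half_line_integrals.
Context {R : realType}.
Implicit Types (f F : R -> R) (C s t l : R).
Let mu := @lebesgue_measure R.

Lemma within_cy_continuous f :
  (forall t, 0 < t -> {for t, continuous f}) -> f t @[t --> 0^'+] --> f 0 ->
  {within `[0, +oo[, continuous f}.
Proof.
move=> cf f0; apply/continuous_within_itvcyP; split=> // t.
by rewrite in_itv/= andbT; exact: cf.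
Qed.

(** The exponential [C exp (- t / 2)] dominates every integrand
[t ^ s exp (- t)]. *)
Lemma cvg_expR_half (C : R) : C * expR (- (t / 2)) @[t --> +oo] --> (0 : R).
Proof.
rewrite -[X in _ --> X](mulr0 C); apply: cvgM; first exact: cvg_cst.
apply: (@cvg_comp _ _ _ (fun t : R => t / 2) (fun t => expR (- t)) _ +oo);
  last exact: cvgr_expR.
have h0 : 0 < 2^-1 :> R by rewrite invr_gt0.
exact: (gt0_cvgMly h0 cvg_id).
Qed.

Lemma continuous_expR_half C t : {for t, continuous (fun t => C * expR (- (t / 2)))}.
Proof.
apply: (@has_derive_continuous _ _ _ (C * (expR (- (t / 2)) * - (1 / 2)))).
by apply: has_derive_eq; [deriv|rewrite /=; field].
Qed.

Lemma integral_expR_half C : 0 <= C ->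
  (\int[mu]_(t in `[0%R, +oo[) (C * expR (- (t / 2)))%:E)%E = (2 * C)%:E.
Proof.
move=> C0; have D t : has_derive (fun t => - 2 * C * expR (- (t / 2))) t
    (C * expR (- (t / 2))).
  by apply: has_derive_eq; [deriv|rewrite /=; field].
rewrite (ge0_continuous_FTC2y (F := fun t => - 2 * C * expR (- (t / 2))) (l := 0)).
- by rewrite mul0r oppr0 expR0 mulr1 -EFinB sub0r mulNr opprK.
- by move=> t _; rewrite mulr_ge0// expR_ge0.
- apply: within_cy_continuous => [t _|]; first exact: continuous_expR_half.
  by apply: cvg_at_right_filter; exact: continuous_expR_half.
- exact: cvg_expR_half.
- by move=> t _; have [] := D t.
- by apply: cvg_at_right_filter; exact: continuous_expR_half.
- by move=> t _; rewrite derive1E; have [_ ->] := D t.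
Qed.

Lemma integrable_expR_half C : 0 <= C ->
  mu.-integrable `[0, +oo[ (EFin \o (fun t => C * expR (- (t / 2)))).
Proof.
move=> C0; apply/integrableP; split.
  apply/measurable_EFinP/measurable_funTS; apply: continuous_measurable_fun.
  by move=> t; exact: continuous_expR_half.
rewrite (_ : integral _ _ _ = (2 * C)%:E) ?ltry// -integral_expR_half//.
by apply: eq_integral => t _ /=; rewrite ger0_norm// mulr_ge0// expR_ge0.
Qed.

Lemma integrable_dominated f C : {within `[0, +oo[, continuous f} ->
  (forall t, 0 <= t -> `|f t| <= C * expR (- (t / 2))) ->
  mu.-integrable `[0, +oo[ (EFin \o f).
Proof.
move=> cf fC; have C0 : 0 <= C.
  by have := fC 0 (lexx 0); rewrite mul0r oppr0 expR0 mulr1; apply: le_trans.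
apply: le_integrable (integrable_expR_half C0) => //=.
  apply/measurable_EFinP/measurable_fun_itv_obnd_cbndP.
  apply: open_continuous_measurable_fun => //.
  by move: cf => /continuous_within_itvcyP[/in_continuous_mksetP cf _].
move=> t; rewrite /= in_itv/= andbT => t0; rewrite lee_fin.
by apply: le_trans (fC t t0) _; exact: ler_norm.
Qed.

Lemma integrable_scale k f : mu.-integrable `[0, +oo[ (EFin \o f) ->
  mu.-integrable `[0, +oo[ (EFin \o (fun t => k * f t)).
Proof. by move=> intf; exact: (integrableZl _ k intf). Qed.

(** The nonnegative version of this fundamental theorem is applied to the sum
of [f] and of the dominating exponential. *)
Lemma FTC2y_dominated f F C l : {within `[0, +oo[, continuous f} ->
  (forall t, 0 <= t -> `|f t| <= C * expR (- (t / 2))) ->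
  (forall t, 0 < t -> has_derive F t (f t)) ->
  F t @[t --> +oo] --> l -> F t @[t --> 0^'+] --> F 0 ->
  \int[mu]_(t in `[0, +oo[) f t = l - F 0.
Proof.
move=> cf fC Ff Fl F0; have C0 : 0 <= C.
  by have := fC 0 (lexx 0); rewrite mul0r oppr0 expR0 mulr1; apply: le_trans.
have [cf1 cf2] := (continuous_within_itvcyP _ _).1 cf.
pose g t := f t + C * expR (- (t / 2)).
pose G t := F t + - 2 * C * expR (- (t / 2)).
have DG t : 0 < t -> has_derive G t (g t).
  move=> /Ff Ft; apply: has_derive_eq.
    by apply: has_derive_add; [exact: Ft|deriv].
  by rewrite /g /=; field.
have intf := integrable_dominated cf fC.
have inte := integrable_expR_half C0.
have E : \int[mu]_(t in `[0, +oo[) g t = l + 0 - G 0.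
  apply: Rintegral_ge0_continuous_FTC2y.
  - move=> t t0; rewrite /g -lerBlDr sub0r.
    by have := fC t t0; rewrite ler_norml => /andP[].
  - apply: within_cy_continuous => [t t0|].
      apply: continuousD; last exact: continuous_expR_half.
      by apply: cf1; rewrite in_itv/= t0.
    apply: cvgD => //.
    by apply: cvg_at_right_filter; exact: continuous_expR_half.
  - by apply: cvgD => //; exact: cvg_expR_half.
  - by move=> t /DG [].
  - apply: cvgD => //.
    by apply: cvg_at_right_filter; exact: continuous_expR_half.
  - move=> t; rewrite in_itv/= andbT => /DG [? Gt].
    by rewrite derive1E.
have : \int[mu]_(t in `[0, +oo[) g t = \int[mu]_(t in `[0, +oo[) f t + 2 * C.
  rewrite /g RintegralD//; congr (_ + _).
  by rewrite /Rintegral integral_expR_half.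
rewrite E /G mul0r oppr0 expR0 mulr1 => H.
have -> : \int[mu]_(t in `[0, +oo[) f t =
  \int[mu]_(t in `[0, +oo[) f t + 2 * C - 2 * C by ring.
by rewrite -H; ring.
Qed.

End half_line_integrals.

Section Gamma_theory.
Context {R : realType}.
Implicit Types (s t x : R).
Let mu := @lebesgue_measure R.

Lemma powR_continuous_pos s t : 0 < t -> {for t, continuous (fun t => t `^ s)}.
Proof. by move=> t0; apply: has_derive_continuous; exact: has_derive_powR. Qed.

Lemma powR_cvg_at0 s : 0 <= s -> t `^ s @[t --> 0^'+] --> (0 : R) `^ s.
Proof.
rewrite le_eqVlt => /orP[/eqP <-|s0]; last by rewrite powR0 ?gt_eqF//; exact: powR_cvg0.
by rewrite powRr0; under eq_fun do rewrite powRr0; exact: cvg_cst.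
Qed.

Lemma continuous_expRN t : {for t, continuous (fun t : R => expR (- t))}.
Proof.
apply: (@has_derive_continuous _ _ _ (- expR (- t))).
by apply: has_derive_eq; [deriv|rewrite /=; ring].
Qed.

Lemma gamma_integrand_continuous s : 0 <= s ->
  {within `[0, +oo[, continuous (fun t : R => t `^ s * expR (- t))}.
Proof.
move=> s0; apply: within_cy_continuous => [t t0|].
  by apply: continuousM; [exact: powR_continuous_pos|exact: continuous_expRN].
apply: cvgM; first exact: powR_cvg_at0.
by apply: cvg_at_right_filter; exact: continuous_expRN.
Qed.

(** From [t / (2 s) <= exp (t / (2 s))], raised to the power [s]. *)
Lemma gamma_integrand_le s : 0 <= s -> exists2 C : R, 0 <= C &
  forall t, 0 <= t -> t `^ s * expR (- t) <= C * expR (- (t / 2)).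
Proof.
rewrite le_eqVlt => /orP[/eqP <-|s0].
  exists 1 => // t t0; rewrite powRr0 !mul1r ler_expR lerN2.
  by rewrite ler_pdivrMr// ler_peMr// ler1n.
exists ((2 * s) `^ s); first exact: powR_ge0.
move=> t t0.
have -> : expR (- (t / 2)) = expR (t / 2) * expR (- t).
  by rewrite -expRD; congr expR; field.
rewrite mulrA ler_wpM2r ?expR_ge0//.
have -> : expR (t / 2) = expR (t / (2 * s)) `^ s.
  by rewrite -expRM; congr expR; field; rewrite gt_eqF.
rewrite -powRM ?expR_ge0//; last by rewrite mulr_ge0// ltW.
apply: ge0_ler_powR; rewrite ?nnegrE//; first exact: ltW.
  by rewrite mulr_ge0 ?expR_ge0// mulr_ge0// ltW.
rewrite -ler_pdivrMl ?mulr_gt0// mulrC.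
by apply: le_trans (expR_ge1Dx _); rewrite lerDr.
Qed.

Lemma gamma_integrable s : 0 <= s ->
  mu.-integrable `[0, +oo[ (EFin \o (fun t => t `^ s * expR (- t))).
Proof.
move=> s0; have [C C0 sC] := gamma_integrand_le s0.
apply: (@integrable_dominated _ _ C); first exact: gamma_integrand_continuous.
by move=> t t0; rewrite ger0_norm ?sC// mulr_ge0 ?powR_ge0 ?expR_ge0.
Qed.

Lemma GammaE x : 1 <= x ->
  Gamma x = \int[mu]_(t in `[0, +oo[) (t `^ (x - 1) * expR (- t)).
Proof.
move=> x1; rewrite /Gamma Rintegral_itv_obnd_cbnd//.
apply: integrableS (gamma_integrable _) => //; last by rewrite subr_ge0.
by move=> t /=; rewrite !in_itv/= !andbT; exact: ltW.
Qed.

Lemma cvg_gamma_integrand s : 0 <= s -> t `^ s * expR (- t) @[t --> +oo] --> (0 : R).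
Proof.
move=> s0; have [C C0 sC] := gamma_integrand_le s0.
apply: (squeeze_cvgr (f := fun=> 0) (h := fun t => C * expR (- (t / 2)))).
- near=> t; have t0 : 0 <= t by near: t; apply: nbhs_pinfty_ge; exact: num_real.
  by rewrite sC// mulr_ge0 ?powR_ge0 ?expR_ge0.
- exact: cvg_cst.
- exact: cvg_expR_half.
Unshelve. all: by end_near. Qed.

(** Integration by parts, in the form of the antiderivative
[- t ^ x * exp (- t)]. *)
Lemma GammaS x : 1 <= x -> Gamma (x + 1) = x * Gamma x.
Proof.
move=> x1; have x0 : 0 < x by apply: lt_le_trans x1.
have xs : 0 <= x - 1 by rewrite subr_ge0.
have x1' : 1 <= x + 1 by rewrite lerDr ltW.
rewrite !GammaE// addrK; apply/eqP; rewrite -subr_eq0; apply/eqP.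
have ix := gamma_integrable (ltW x0); have ixs := gamma_integrable xs.
rewrite -RintegralZl// -RintegralB//; last exact: integrable_scale.
have [C C0 hC] := gamma_integrand_le (ltW x0).
have [C' C'0 hC'] := gamma_integrand_le xs.
rewrite (@FTC2y_dominated _ _ (fun t => - (t `^ x * expR (- t))) (C + x * C') 0).
- by rewrite powR0 ?gt_eqF// mul0r !oppr0 addr0.
- apply: within_cy_continuous => [t t0|].
    apply: continuousB.
      by apply: continuousM; [exact: powR_continuous_pos|exact: continuous_expRN].
    apply: continuousM; first exact: cst_continuous.
    by apply: continuousM; [exact: powR_continuous_pos|exact: continuous_expRN].
  apply: cvgB.
    apply: cvgM; first by apply: powR_cvg_at0; exact: ltW.
    by apply: cvg_at_right_filter; exact: continuous_expRN.
  apply: cvgM; first exact: cvg_cst.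
  apply: cvgM; first exact: powR_cvg_at0.
  by apply: cvg_at_right_filter; exact: continuous_expRN.
- move=> t t0; apply: le_trans (ler_normB _ _) _.
  rewrite mulrDl; apply: lerD.
    by rewrite ger0_norm ?hC// mulr_ge0 ?powR_ge0 ?expR_ge0.
  rewrite ger0_norm; first by rewrite -[leRHS]mulrA ler_wpM2l ?hC'// ltW.
  by rewrite mulr_ge0 ?(ltW x0)// mulr_ge0 ?powR_ge0 ?expR_ge0.
- by move=> t t0; apply: has_derive_eq; [deriv|rewrite /=; ring].
- by rewrite -oppr0; apply: cvgN; apply: cvg_gamma_integrand; exact: ltW.
- apply: cvgN; apply: cvgM; first by apply: powR_cvg_at0; exact: ltW.
  by apply: cvg_at_right_filter; exact: continuous_expRN.
Qed.

Lemma Gamma1 : Gamma 1 = 1 :> R.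
Proof.
rewrite GammaE// subrr.
have [C C0 hC] := gamma_integrand_le (lexx (0 : R)).
rewrite (@FTC2y_dominated _ _ (fun t => - expR (- t)) C 0).
- by rewrite oppr0 expR0 sub0r opprK.
- exact: gamma_integrand_continuous.
- by move=> t t0; rewrite ger0_norm ?hC// mulr_ge0 ?powR_ge0 ?expR_ge0.
- by move=> t t0; apply: has_derive_eq; [deriv|rewrite powRr0 /=; ring].
- by rewrite -oppr0; apply: cvgN; exact: cvgr_expR.
- by apply: cvgN; apply: cvg_at_right_filter; exact: continuous_expRN.
Qed.

(** Young's inequality for [t ^ (1 - d)], integrated. *)
Lemma Gamma_interpolation x d : 1 <= x -> 0 < d < 1 ->
  Gamma (x + 1) <= Gamma (x + d) * (x + d) `^ (1 - d).
Proof.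
move=> x1 /andP[d0 d1]; have x0 : 0 < x by apply: lt_le_trans x1.
pose c := x + d; have c0 : 0 < c by rewrite addr_gt0.
have xd1 : 1 <= x + d by rewrite (le_trans x1)// lerDl ltW.
have d10 : 0 < 1 - d by rewrite subr_gt0.
have young t : 0 <= t -> t `^ (1 - d) <= c `^ (1 - d) * ((1 - d) * (t / c) + d).
  move=> t0.
  have -> : t `^ (1 - d) = c `^ (1 - d) * (t / c) `^ (1 - d).
    by rewrite -powRM ?(ltW c0) ?divr_ge0 ?(ltW c0)// mulrC divfK// gt_eqF.
  rewrite ler_wpM2l ?powR_ge0//.
  apply: le_trans (powR_le_affine _ _) _.
  - by rewrite divr_ge0// ltW.
  - by rewrite d10 ltrBlDr ltrDl.
  - by rewrite (_ : 1 - (1 - d) = d)//; ring.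
have i1 : 0 <= x by exact: ltW.
have i2 : 0 <= x + d - 1 by rewrite subr_ge0.
have i3 : 0 <= x + d by exact: ltW.
have E1 := gamma_integrable i1; have E2 := gamma_integrable i2.
have E3 := gamma_integrable i3.
pose k1 := c `^ (1 - d) * (1 - d) / c; pose k2 := c `^ (1 - d) * d.
have -> : Gamma (x + d) * (x + d) `^ (1 - d) =
    k1 * Gamma (x + d + 1) + k2 * Gamma (x + d).
  by rewrite GammaS// /k1 /k2 /c; field; rewrite gt_eqF.
have h1 : 1 <= x + 1 by rewrite lerDr.
have h2 : 1 <= x + d + 1 by rewrite lerDr.
rewrite !GammaE//.
rewrite !addrK -!RintegralZl// -RintegralD//; last 2 first.
- exact: integrable_scale.
- exact: integrable_scale.
apply: le_Rintegral => //.
  exact: (integrableD _ (integrable_scale k1 E3) (integrable_scale k2 E2)).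
move=> t /=; rewrite in_itv/= andbT => t0.
rewrite !mulrA -mulrDl ler_wpM2r ?expR_ge0//.
have -> : t `^ x = t `^ (x + d - 1) * t `^ (1 - d).
  have e : x + d - 1 + (1 - d) = x by ring.
  by rewrite -powRD e// gt_eqF.
have -> : t `^ (x + d) = t `^ (x + d - 1) * t.
  by rewrite mulrC mulr_powRB1.
apply: le_trans (ler_wpM2l (powR_ge0 _ _) (young t t0)) _.
by rewrite le_eqVlt; apply/orP; left; apply/eqP; rewrite /k1 /k2; field; rewrite gt_eqF.
Qed.

(** The functional equation reduces to [1 <= x < 2], where the interpolation
inequality compares [Gamma x] with [Gamma 2 = 1]. *)
Lemma Gamma_gt0 x : 1 <= x -> 0 < Gamma x.
Proof.
have [n nx] : exists n : nat, x <= n.+1%:R.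
  exists (Num.truncn x); have [x0|x0] := leP 0 x; last first.
    by rewrite (le_trans (ltW x0)).
  by rewrite ltW// truncnS_gt.
elim: n x nx => [|n IH] x nx x1.
  by rewrite (_ : x = 1) ?Gamma1//; apply/eqP; rewrite eq_le nx x1.
have [xlt2|xge2] := ltP x 2; last first.
  have y1 : 1 <= x - 1 by rewrite lerBrDr.
  rewrite -[x](subrK 1) GammaS// mulr_gt0//; first exact: lt_le_trans y1.
  by apply: IH => //; rewrite lerBlDr natr1.
have [->|xn1] := eqVneq x 1; first by rewrite Gamma1.
have d01 : 0 < x - 1 < 1.
  rewrite subr_gt0 lt_neqAle eq_sym xn1 x1/= ltrBlDr.
  by rewrite (_ : 1 + 1 = 2).
have := Gamma_interpolation (lexx 1) d01.
rewrite GammaS// Gamma1 mulr1 (addrC 1 (x - 1)) subrK => h.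
have := lt_le_trans ltr01 h.
by rewrite pmulr_lgt0// powR_gt0// (lt_le_trans _ x1).
Qed.

Import gauss_integral_proof.

(** The square of [\int_0^x exp (- s ^ 2) ds] tends to [pi / 4]. *)
Lemma integral0_gauss_cvg : @integral0_gauss R x @[x --> +oo] --> Num.sqrt pi / 2.
Proof.
have : Num.sqrt (@integral0_gauss R x ^+ 2) @[x --> +oo] --> Num.sqrt (pi / 4).
  apply: continuous_cvg; first exact: sqrt_continuous.
  exact: cvg_integral0_gauss_sqr.
rewrite sqrtrM ?pi_ge0// sqrtrV// (_ : 4 = 2 ^+ 2); last by rewrite expr2 -natrM.
rewrite sqrtr_sqr ger0_norm//.
rewrite (_ : (fun _ => Num.sqrt _) = @integral0_gauss R)//.
by apply/funext => r; rewrite sqrtr_sqr ger0_norm// integral0_gauss_ge0.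
Qed.

Lemma gauss_fun_integrable (a b : R) : mu.-integrable `[a, b] (EFin \o @gauss_fun R).
Proof.
apply: continuous_compact_integrable; first exact: segment_compact.
by apply: continuous_subspaceT; exact: continuous_gauss_fun.
Qed.

Lemma integral0_gauss_derive x : 0 < x ->
  has_derive (@integral0_gauss R) x (gauss_fun x).
Proof.
move=> x0; have xx : x < x + 1 by rewrite ltrDl.
have [] := @continuous_FTC1_closed R gauss_fun 0 x (x + 1) xx
  (gauss_fun_integrable _ _) x0 (@continuous_gauss_fun R x).
by move=> dF; rewrite derive1E => F'; split.
Qed.

Lemma integral0_gauss_cvg0 : @integral0_gauss R x @[x --> 0] --> (0 : R).
Proof.
apply: (parameterized_integral_cvg_left ltr01).
exact: gauss_fun_integrable.
Qed.

(** The antiderivative of [sqrt t * exp (- t)] is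
[- sqrt t * exp (- t) + \int_0^(sqrt t) exp (- s ^ 2) ds]. *)
Lemma Gamma_3_2 : Gamma (3 / 2) = Num.sqrt pi / 2 :> R.
Proof.
have h1 : 1 <= 3 / 2 :> R by rewrite ler_pdivlMr// mul1r ler_nat.
rewrite GammaE// (_ : 3 / 2 - 1 = 2^-1 :> R); last by field.
have h0 : 0 <= 2^-1 :> R by rewrite invr_ge0.
have [C C0 hC] := gamma_integrand_le h0.
have sqrt0 : Num.sqrt t @[t --> 0^'+] --> (0 : R).
  rewrite -[X in _ --> X]sqrtr0; apply: cvg_at_right_filter.
  exact: sqrt_continuous.
rewrite (@FTC2y_dominated _ _
  (fun t => - (t `^ 2^-1 * expR (- t)) + integral0_gauss (Num.sqrt t)) C
  (- 0 + Num.sqrt pi / 2)).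
- rewrite sqrtr0 /integral0_gauss set_itv1 Rintegral_set1.
  by rewrite powR0 ?invr_eq0// mul0r oppr0 !add0r subr0.
- exact: gamma_integrand_continuous.
- by move=> t t0; rewrite ger0_norm ?hC// mulr_ge0 ?powR_ge0 ?expR_ge0.
- move=> t t0; have st0 : 0 < Num.sqrt t by rewrite sqrtr_gt0.
  apply: has_derive_eq.
    apply: has_derive_add; first by deriv.
    by apply: has_derive_comp; [exact: integral0_gauss_derive|exact: is_derive1_sqrt].
  rewrite /= /gauss_fun sqr_sqrtr ?(ltW t0)//.
  have -> : t `^ (2^-1 - 1) = (Num.sqrt t)^-1.
    rewrite (_ : 2^-1 - 1 = - 2^-1); last by field.
    by rewrite powRN powR12_sqrt// ltW.
  by rewrite powR12_sqrt ?(ltW t0)//; field; rewrite gt_eqF.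
- apply: cvgD; first by apply: cvgN; exact: cvg_gamma_integrand.
  apply: (@cvg_comp _ _ _ Num.sqrt (@integral0_gauss R) _ +oo);
    last exact: integral0_gauss_cvg.
  apply/cvgryPge => A; near=> u.
  by apply: le_trans (ler_norm A) _; rewrite -sqrtr_sqr ler_wsqrtr.
- have -> : integral0_gauss (Num.sqrt 0) = 0 :> R.
    by rewrite sqrtr0 /integral0_gauss set_itv1 Rintegral_set1.
  apply: cvgD.
    apply: cvgN; apply: cvgM; first exact: powR_cvg_at0.
    by apply: cvg_at_right_filter; exact: continuous_expRN.
  by apply: cvg_comp integral0_gauss_cvg0; exact: sqrt0.
Unshelve. all: by end_near. Qed.

End Gamma_theory.

(** * The amplitude on the positive real axis *)

Section coefficients.
Context {R : realType}.
Implicit Types nu x : R.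

Lemma tcoefSS nu n : tcoef nu n.*2.+2 =
  tcoef nu n.*2 / ((n.*2.+1%:R + (2 * nu + 1)) * n.*2.+2%:R).
Proof.
by rewrite [LHS]/= odd_double /= addr0 invfM mulrA.
Qed.

Lemma tcoef_odd nu n : tcoef nu n.*2.+1 = tcoef nu n.*2 / (n.*2.+1%:R + (2 * nu + 1)).
Proof. by rewrite [LHS]/= odd_double. Qed.

(** The coefficients of [I_(nu+1)] appear twice: as those of [Q] at order [nu],
and as those of [P] at order [nu + 1]. *)
Lemma tcoef_index nu n : 0 <= nu ->
  tcoef nu n.*2.+1 = (2 * nu + 2)^-1 * tcoef (nu + 1) n.*2.
Proof.
move=> nu0; elim: n => [|n IH].
  by rewrite tcoef_odd double0 /= mulr1 mul1r; congr (_^-1); ring.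
rewrite tcoef_odd !doubleS !tcoefSS.
have E : tcoef (nu + 1) n.*2 = (2 * nu + 2) * tcoef nu n.*2.+1.
  by rewrite IH mulrA mulfV ?mul1r// gt_eqF// ltr_wpDl// mulr_ge0.
rewrite E tcoef_odd.
have e3 : n.*2.+3%:R = n.*2%:R + 3 :> R by rewrite -addn3 natrD.
have e2 : n.*2.+2%:R = n.*2%:R + 2 :> R by rewrite -addn2 natrD.
have e1 : n.*2.+1%:R = n.*2%:R + 1 :> R by rewrite -addn1 natrD.
rewrite e1 e2 e3.
have : 0 <= n.*2%:R :> R by [].
move: (n.*2%:R : R) (tcoef nu n.*2) => m t m0.
by field; apply/and4P; split; rewrite gt_eqF//; lra.
Qed.

Lemma unshift_Q nu : 0 <= nu ->
  unshift (Qcoef nu) = (fun n => (2 * nu + 2)^-1 * Pcoef (nu + 1) n).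
Proof.
move=> nu0; apply/funext => n; rewrite /unshift /Qcoef /Pcoef [odd n.+1]/=.
have [on|on] /= := boolP (odd n); first by rewrite mulr0.
have -> : n = n./2.*2 by rewrite -[LHS]odd_double_half (negbTE on).
exact: tcoef_index.
Qed.

(** Interpolation of the coefficients in the order: [1 / (y + d)] is below the
weighted geometric mean of [1 / y] and [1 / (y + 1)]. *)
Lemma tcoef_interpolation nu (d : R) n : 0 <= nu -> 0 < d < 1 ->
  tcoef (nu + d) n.*2 <= tcoef nu n.*2 * ((nu + 1) / (n%:R + nu + 1)) `^ d.
Proof.
move=> nu0 d01; have /andP[d0 d1] := d01.
elim: n => [|n IH].
  by rewrite /= add0r mul1r divff ?powR1// gt_eqF// ltr_wpDl.
have n0 : 0 <= n%:R :> R by [].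
rewrite doubleS !tcoefSS.
have e1 : n.*2.+1%:R = 2 * n%:R + 1 :> R by rewrite -addn1 natrD -mul2n natrM.
have e2 : n.*2.+2%:R = 2 * n%:R + 2 :> R by rewrite -addn2 natrD -mul2n natrM.
have e3 : n.+1%:R = n%:R + 1 :> R by rewrite natr1.
rewrite e1 e2 e3; move: (n%:R : R) n0 IH => m m0 IH.
pose y := m + nu + 1; have y0 : 0 < y by rewrite /y; lra.
pose u := y / (y + 1); have u0 : 0 < u by rewrite divr_gt0//; lra.
have Eu : (nu + 1) / (m + 1 + nu + 1) = (nu + 1) / (m + nu + 1) * u.
  by rewrite /u /y; field; apply/andP; split; rewrite gt_eqF//; lra.
have q0 : 0 <= (nu + 1) / (m + nu + 1) by rewrite divr_ge0//; lra.
rewrite Eu powRM//; last exact: ltW.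
have step : (2 * m + 1 + (2 * (nu + d) + 1))^-1 <=
    (2 * m + 1 + (2 * nu + 1))^-1 * u `^ d.
  have -> : 2 * m + 1 + (2 * (nu + d) + 1) = 2 * (y + d) by rewrite /y; ring.
  have -> : 2 * m + 1 + (2 * nu + 1) = 2 * y by rewrite /y; ring.
  rewrite !invfM -mulrA ler_wpM2l// ?invr_ge0//.
  have -> : u `^ d = ((1 + y^-1) `^ d)^-1.
    rewrite -powRN (_ : u = (1 + y^-1)^-1); last first.
      by rewrite /u; field; apply/andP; split; rewrite gt_eqF//; lra.
    by rewrite -powR_inv1 ?addr_ge0 ?invr_ge0 ?ltW// -powRrM mulN1r.
  have v0 : 0 <= 1 + y^-1 by rewrite addr_ge0// invr_ge0 ltW.
  have vp : 0 < (1 + y^-1) `^ d by rewrite powR_gt0// ltr_pwDl// invr_ge0 ltW.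
  rewrite -invfM lef_pV2 ?posrE ?mulr_gt0//; last by rewrite addr_gt0.
  apply: le_trans (ler_wpM2l (ltW y0) (powR_le_affine v0 d01)) _.
  by rewrite le_eqVlt; apply/orP; left; apply/eqP; field; rewrite gt_eqF.
rewrite !invfM.
set A := (_ + (2 * (nu + d) + 1))^-1 in step *.
set B := (2 * m + 2)^-1; set A' := (_ + (2 * nu + 1))^-1 in step *.
have B0 : 0 <= B by rewrite invr_ge0; lra.
have A0 : 0 <= A by rewrite invr_ge0; lra.
have -> : tcoef (nu + d) n.*2 * (A * B) = tcoef (nu + d) n.*2 * A * B by ring.
set q := (_ / _) `^ d in IH *.
have -> : tcoef nu n.*2 * (A' * B) * (q * u `^ d) =
  tcoef nu n.*2 * q * (A' * u `^ d) * B by ring.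
apply: (ler_wpM2r B0); apply: ler_pM => //.
by rewrite ltW// tcoef_gt0// addr_ge0// ltW.
Qed.

End coefficients.

Section real_axis.
Context {R : realType}.
Implicit Types nu x : R.

Lemma re_axisE (c : nat -> R) x : reS c x 0 = Sum (fun n => c n * x ^+ n).
Proof. by congr Sum; apply/funext => n; rewrite mulr0 cos0 mulr1. Qed.

Lemma im_axisE (c : nat -> R) x : imS c x 0 = 0.
Proof. by apply: Sum_zero => n; rewrite mulr0 sin0 mulr0. Qed.

Lemma re_axis_summable (c : nat -> R) x : entire c ->
  summable_seq (fun n => c n * x ^+ n).
Proof.
move=> /(summable_re (r := x) (theta := 0)).
by under eq_fun do rewrite mulr0 cos0 mulr1.
Qed.

Arguments re_axis_summable [c] x.

Lemma re_axis_ge0 (c : nat -> R) x : entire c -> (forall n, 0 <= c n) -> 0 <= x ->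
  0 <= reS c x 0.
Proof.
move=> ec c0 x0; rewrite re_axisE; apply: Sum_ge0; first exact: re_axis_summable.
by move=> n; rewrite mulr_ge0// exprn_ge0.
Qed.

Lemma re_at0 (c : nat -> R) theta : entire c -> reS c 0 theta = c 0%N.
Proof.
move=> ec; rewrite /reS.
rewrite (_ : (fun _ => _) = (fun n => c 0%N * (n == 0%N)%:R)); last first.
  apply/funext => -[|n]; first by rewrite expr0 mul0r cos0 !mulr1.
  by rewrite expr0n/= mulr0 mul0r mulr0.
have H : series (fun n : nat => (n == 0%N)%:R) @ \oo --> (1 : R).
  rewrite -cvg_shiftS/=; apply: cvg_near_cst; apply: nearW => n.
  by rewrite /series/= big_nat_recl//= big1 ?addr0.
rewrite Sum_scale; last by apply/cvg_ex; exists 1.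
by rewrite /Sum (cvg_lim _ H)// mulr1.
Qed.

Definition axisP nu x : R := reS (Pcoef nu) x 0.
Definition axisQ nu x : R := reS (Qcoef nu) x 0.
Definition axisL nu x : R := reS (unshift (Qcoef nu)) x 0.

Section fixed_order.
Variable nu : R.
Hypothesis nu0 : 0 <= nu.

Local Notation P := (axisP nu).
Local Notation Q := (axisQ nu).
Local Notation L := (axisL nu).

Let eP := entire_P nu0.
Let eQ := entire_Q nu0.
Let eL := entire_unshift eQ.

Lemma Pcoef_ge0 n : 0 <= Pcoef nu n.
Proof. by rewrite /Pcoef; case: ifP => // _; rewrite ltW// tcoef_gt0. Qed.

Lemma Qcoef_ge0 n : 0 <= Qcoef nu n.
Proof. by rewrite /Qcoef; case: ifP => // _; rewrite ltW// tcoef_gt0. Qed.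

Lemma Q_eq x : Q x = x * L x.
Proof. by rewrite /axisQ reS_unshift// cos0 sin0 mul0r subr0 mul1r. Qed.

Lemma P_derive x : has_derive P x (Q x).
Proof.
by apply: has_derive_eq (P1_radial nu0 _ _) _; rewrite cos0 sin0 mul0r subr0 mul1r.
Qed.

Lemma Q_derive x : has_derive Q x (P x - (2 * nu + 1) * L x).
Proof.
apply: has_derive_eq (reS_radial _ _ eQ) _.
rewrite cos0 sin0 mul0r subr0 mul1r dcoef_Q// reS_lin//.
by rewrite mul1r mulNr.
Qed.

Lemma P_ge1 x : 0 <= x -> 1 <= P x.
Proof.
move=> x0; rewrite /axisP re_axisE.
have -> : 1 = Pcoef nu 0 * x ^+ 0 by rewrite expr0 mulr1.
apply: Sum_ge_first; first exact: re_axis_summable.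
by move=> n; rewrite mulr_ge0 ?Pcoef_ge0 ?exprn_ge0.
Qed.

Lemma Q_ge0 x : 0 <= x -> 0 <= Q x.
Proof. by apply: re_axis_ge0 => //; exact: Qcoef_ge0. Qed.

(** [(P - Q) exp x] has the nonnegative derivative
[(2 nu + 1) (Q / x) exp x]. *)
Lemma Q_le_P x : 0 <= x -> Q x <= P x.
Proof.
move=> x0.
have D y : has_derive (fun y => (P y - Q y) * expR y) y
    ((2 * nu + 1) * L y * expR y).
  have Py := P_derive y; have Qy := Q_derive y.
  apply: has_derive_eq.
    apply: has_derive_mul; last by deriv.
    by apply: has_derive_add; [exact: Py|apply: has_derive_opp; exact: Qy].
  by rewrite /=; ring.
have : (P 0 - Q 0) * expR 0 <= (P x - Q x) * expR x.
  apply: (@derive_ge0_le _ _ _ 0 x x0 (fun y _ => D y)) => y /andP[y0 _].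
  rewrite mulr_ge0 ?expR_ge0// mulr_ge0//; first by rewrite addr_ge0// mulr_ge0.
  by apply: re_axis_ge0 => // n; exact: Qcoef_ge0.
rewrite /axisP /axisQ !re_at0// /Pcoef /Qcoef/= subr0 expR0 mul1r => h.
rewrite -subr_ge0 -(pmulr_lge0 _ (expR_gt0 x)).
exact: le_trans h.
Qed.

End fixed_order.

Section consecutive_orders.
Variable nu : R.
Hypothesis nu0 : 0 <= nu.

Local Notation P := axisP.
Local Notation Q := axisQ.

Let nu1 : 0 <= nu + 1. Proof. by rewrite addr_ge0. Qed.

Lemma unshift_Q_axis x theta :
  reS (unshift (Qcoef nu)) x theta = (2 * nu + 2)^-1 * reS (Pcoef (nu + 1)) x theta.
Proof.
rewrite unshift_Q// /reS -Sum_scale; last exact/summable_re/entire_P.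
by congr Sum; apply/funext => n; ring.
Qed.

Lemma Q_next x : Q nu x = x / (2 * nu + 2) * P (nu + 1) x.
Proof. by rewrite Q_eq// /axisL unshift_Q_axis mulrA. Qed.

(** [I_nu = I_(nu+2) + 2 (nu + 1) / x I_(nu+1)], read off from the two ways of
differentiating [Q]. *)
Lemma P_recurrence x : P nu x = P (nu + 1) x + x / (2 * nu + 2) * Q (nu + 1) x.
Proof.
have d0 : 2 * nu + 2 != 0 by rewrite gt_eqF// ltr_wpDl// mulr_ge0.
have D1 := Q_derive nu0 x; rewrite /axisL unshift_Q_axis -/(axisP (nu + 1) x) in D1.
have D2 : has_derive (Q nu) x
    (x / (2 * nu + 2) * Q (nu + 1) x + P (nu + 1) x / (2 * nu + 2)).
  have Px := P_derive nu1 x.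
  rewrite (_ : Q nu = fun x => x / (2 * nu + 2) * P (nu + 1) x); last first.
    by apply/funext => y; exact: Q_next.
  apply: has_derive_eq.
    by apply: has_derive_mul; [deriv|exact: Px].
  by rewrite /=; ring.
have := has_derive_unique D1 D2; move=> /eqP; rewrite subr_eq => /eqP ->.
by field.
Qed.

(** In the recurrence the first term is [Q (2 nu + 2) / x], and the second is at
most [Q] by [Q_le_P] at the next order. *)
Lemma P_le_Q x : 0 < x -> P nu x <= Q nu x * (1 + (2 * nu + 2) / x).
Proof.
move=> x0; have d0 : 0 < 2 * nu + 2 by rewrite ltr_wpDl// mulr_ge0.
rewrite Q_next P_recurrence.
have -> : x / (2 * nu + 2) * P (nu + 1) x * (1 + (2 * nu + 2) / x) =
    P (nu + 1) x + x / (2 * nu + 2) * P (nu + 1) x.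
  by field; rewrite !gt_eqF.
rewrite lerD2l ler_wpM2l ?divr_ge0 ?(ltW x0) ?(ltW d0)//.
by apply: Q_le_P => //; exact: ltW.
Qed.

(** [I_(nu+1) / I_nu] tends to [1], by the two preceding comparisons. *)
Lemma ratio_cvg : Q nu x / P nu x @[x --> +oo] --> (1 : R).
Proof.
apply: (squeeze_cvgr (f := fun x => (1 + (2 * nu + 2) / x)^-1) (h := fun=> 1)).
- near=> x; have x0 : 0 < x by near: x; apply: nbhs_pinfty_gt; exact: num_real.
  have P0 : 0 < P nu x by rewrite (lt_le_trans ltr01)// P_ge1// ltW.
  rewrite ler_pdivrMr// mul1r Q_le_P ?(ltW x0)// andbT.
  have k0 : 0 < 1 + (2 * nu + 2) / x.
    by rewrite addr_gt0// divr_gt0// ltr_wpDl// mulr_ge0.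
  rewrite ler_pdivlMr// -ler_pdivlMl ?invr_gt0// invrK mulrC.
  exact: P_le_Q.
- rewrite -[X in _ --> X]invr1; apply: cvgV; first exact: oner_neq0.
  rewrite -[X in _ --> X]addr0; apply: cvgD; first exact: cvg_cst.
  exact: cvg_div_pinfty.
- exact: cvg_cst.
Unshelve. all: by end_near. Qed.

(** The function [g] on the positive axis, that is [x ^ (1/2) exp (- x) I_mu]
without its constant factor. *)
Definition growth mu x : R := x `^ (mu + 1 / 2) * expR (- x) * P mu x.

(** On the real axis [energyX] is the square of [g' + 2 g], and
[g' = g (Q / P - 1 + a / x)]. *)
Lemma energyX_axis x : 0 < x -> Num.sqrt (energyX nu x 0) =
  growth nu x * (1 + Q nu x / P nu x + (nu + 1 / 2) / x).
Proof.
move=> x0; have P0 : 0 < P nu x by rewrite (lt_le_trans ltr01)// P_ge1// ltW.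
have -> : energyX nu x 0 =
   (growth nu x * (1 + Q nu x / P nu x + (nu + 1 / 2) / x)) ^+ 2.
  rewrite /energyX /weight /X1 /X2 /rotP1 /rotP2 cos0 sin0 !im_axisE /growth
    -/(axisP nu x) -/(axisQ nu x).
  have -> : x `^ (2 * nu + 1) = (x `^ (nu + 1 / 2)) ^+ 2.
    by rewrite -powR_mulrn ?powR_ge0// -powRrM; congr (_ `^ _); field.
  have -> : expR (-2 * 1 * x) = expR (- x) ^+ 2.
    by rewrite -expRM_natl; congr expR; ring.
  by field; rewrite !gt_eqF.
rewrite sqrtr_sqr ger0_norm//.
rewrite mulr_ge0//.
  by rewrite mulr_ge0 ?(ltW P0)// mulr_ge0 ?powR_ge0 ?expR_ge0.
rewrite addr_ge0//; last by rewrite divr_ge0 ?(ltW x0)// addr_ge0.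
by rewrite addr_ge0// divr_ge0 ?(ltW P0)// Q_ge0// ltW.
Qed.

Lemma growth_cvg_energy l : energyX nu x 0 @[x --> +oo] --> l ->
  growth nu x @[x --> +oo] --> Num.sqrt l / 2.
Proof.
move=> El.
have sl : Num.sqrt (energyX nu x 0) @[x --> +oo] --> Num.sqrt l.
  by apply: continuous_cvg => //; exact: sqrt_continuous.
have r2 : 1 + Q nu x / P nu x + (nu + 1 / 2) / x @[x --> +oo] --> (2 : R).
  rewrite (_ : 2 = 1 + 1 + 0); last by rewrite addr0.
  apply: cvgD; last exact: cvg_div_pinfty.
  by apply: cvgD; [exact: cvg_cst|exact: ratio_cvg].
have H : Num.sqrt (energyX nu x 0) / (1 + Q nu x / P nu x + (nu + 1 / 2) / x)
    @[x --> +oo] --> Num.sqrt l / 2.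
  by apply: cvgM => //; apply: cvgV.
apply: cvg_trans H; apply: near_eq_cvg; near=> x.
have x0 : 0 < x by near: x; apply: nbhs_pinfty_gt; exact: num_real.
have P0 : 0 < P nu x by rewrite (lt_le_trans ltr01)// P_ge1// ltW.
rewrite energyX_axis// mulfK// gt_eqF//.
rewrite ltr_wpDr ?divr_ge0 ?(ltW x0) ?addr_ge0//.
by rewrite ltr_wpDr// divr_ge0 ?(ltW P0)// Q_ge0// ltW.
Unshelve. all: by end_near. Qed.

Lemma growth_next x : 0 < x ->
  growth (nu + 1) x = (2 * nu + 2) * growth nu x * (Q nu x / P nu x).
Proof.
move=> x0; have P0 : 0 < P nu x by rewrite (lt_le_trans ltr01)// P_ge1// ltW.
have d0 : 0 < 2 * nu + 2 by rewrite ltr_wpDl// mulr_ge0.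
have -> : Q nu x / P nu x = x / (2 * nu + 2) * P (nu + 1) x / P nu x.
  by rewrite -Q_next.
rewrite /growth (_ : nu + 1 + 1 / 2 = nu + 1 / 2 + 1); last by ring.
have -> : x `^ (nu + 1 / 2 + 1) = x `^ (nu + 1 / 2) * x.
  by rewrite (@powRD _ x (nu + 1 / 2) 1) ?powRr1 ?(ltW x0)// (gt_eqF x0) implybT.
by field; rewrite !gt_eqF.
Qed.

(** Summing the interpolation of the coefficients, made affine by the weighted
arithmetic-geometric mean, compares [P] at order [nu + d] with a mixture of
[P] and [Q] at order [nu], and [Q <= P]. *)
Lemma P_interpolation (d x : R) : 0 < d < 1 -> 0 < x ->
  P (nu + d) x <= ((2 * nu + 2) / x) `^ d * P nu x.
Proof.
move=> d01 x0; have /andP[d0 d1] := d01.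
have nd0 : 0 <= nu + d by rewrite addr_ge0// ltW.
pose T := (2 * nu + 2) / x.
have T0 : 0 < T by rewrite divr_gt0// ltr_wpDl// mulr_ge0.
have : P (nu + d) x <= T `^ d * ((1 - d) * P nu x + d * Q nu x).
  have sP := re_axis_summable x (entire_P nu0).
  have sQ := re_axis_summable x (entire_Q nu0).
  have sPd := re_axis_summable x (entire_P nd0).
  have u0 : forall n, Qcoef nu n.*2 * x ^+ n.*2 = 0.
    by move=> n; rewrite /Qcoef odd_double mul0r.
  have u1 mu : forall n, Pcoef mu n.*2.+1 * x ^+ n.*2.+1 = 0.
    by move=> n; rewrite /Pcoef/= odd_double mul0r.
  rewrite /axisP /axisQ !re_axisE (Sum_even sPd (u1 _)) (Sum_even sP (u1 _)).
  have seP := summable_even sP (u1 _); have soQ := summable_odd sQ u0.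
  rewrite (Sum_odd sQ u0) -(Sum_lin _ _ seP soQ).
  have sPQ := summable_add (summable_scale (1 - d) seP) (summable_scale d soQ).
  rewrite -(Sum_scale _ sPQ).
  apply: Sum_le.
  - exact: (summable_even sPd (u1 _)).
  - exact: (summable_scale _ sPQ).
  move=> n.
  have EP mu : Pcoef mu n.*2 = tcoef mu n.*2 by rewrite /Pcoef odd_double.
  have EQ : Qcoef nu n.*2.+1 = tcoef nu n.*2.+1 by rewrite /Qcoef/= odd_double.
  rewrite !EP EQ tcoef_odd exprS.
  have x2 : 0 <= x ^+ n.*2 by rewrite exprn_ge0// ltW.
  apply: le_trans (ler_wpM2r x2 (tcoef_interpolation n nu0 d01)) _.
  (* [v] is the ratio of the [Q] term of index [2 n + 1] to the [P] term of
     index [2 n]; the scale [T] is chosen so that no [x] remains *)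
  pose v := x / (2 * (n%:R + nu + 1)).
  have n0 : 0 <= n%:R :> R by [].
  have v0 : 0 <= v by rewrite divr_ge0 ?(ltW x0)//; lra.
  have -> : (nu + 1) / (n%:R + nu + 1) = T * v.
    by rewrite /T /v; field; rewrite (gt_eqF x0) andbT gt_eqF//; lra.
  rewrite powRM ?(ltW T0)//.
  have -> : n.*2.+1%:R = 2 * n%:R + 1 :> R by rewrite -addn1 natrD -mul2n natrM.
  have -> : T `^ d * ((1 - d) * (tcoef nu n.*2 * x ^+ n.*2) +
      d * (tcoef nu n.*2 / (2 * n%:R + 1 + (2 * nu + 1)) * (x * x ^+ n.*2))) =
      tcoef nu n.*2 * (T `^ d * (d * v + (1 - d))) * x ^+ n.*2.
    by rewrite /v; field; apply/andP; split; rewrite gt_eqF//; lra.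
  apply: (ler_wpM2r x2); apply: ler_wpM2l; first by rewrite ltW// tcoef_gt0.
  by apply: ler_wpM2l; [exact: powR_ge0|exact: powR_le_affine].
move=> /le_trans; apply; apply: ler_wpM2l; first exact: powR_ge0.
have h : d * Q nu x <= d * P nu x by rewrite ler_pM2l// Q_le_P// ltW.
apply: (@le_trans _ _ ((1 - d) * P nu x + d * P nu x)); first by rewrite lerD2l.
by rewrite le_eqVlt; apply/orP; left; apply/eqP; ring.
Qed.

Lemma growth_interpolation (d x : R) : 0 < d < 1 -> 0 < x ->
  growth (nu + d) x <= (2 * nu + 2) `^ d * growth nu x.
Proof.
move=> d01 x0; have k0 : 0 <= 2 * nu + 2 by rewrite addr_ge0// mulr_ge0.
have := P_interpolation d01 x0; rewrite /growth.
have -> : x `^ (nu + d + 1 / 2) = x `^ (nu + 1 / 2) * x `^ d.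
  rewrite -powRD; first by congr (_ `^ _); ring.
  by rewrite (gt_eqF x0) implybT.
have -> : ((2 * nu + 2) / x) `^ d = (2 * nu + 2) `^ d / x `^ d.
  by rewrite powR_div.
have xd : 0 < x `^ d by rewrite powR_gt0.
have w0 : 0 <= x `^ (nu + 1 / 2) * x `^ d * expR (- x).
  by rewrite !mulr_ge0 ?powR_ge0 ?expR_ge0.
move=> /(ler_wpM2l w0) /le_trans; apply.
by rewrite le_eqVlt; apply/orP; left; apply/eqP; field; rewrite gt_eqF.
Qed.

End consecutive_orders.
End real_axis.

Section amplitude.
Local Opaque Gamma.
Context {R : realType}.
Implicit Types nu mu : R.

(** [lim x^(1/2) exp (- x) I_nu (x)]. *)
Definition amplitude nu : R :=
  lim (growth nu x @[x --> +oo]) / (2 `^ nu * Gamma (nu + 1)).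

Lemma growth_is_cvg nu : 0 <= nu -> cvg (growth nu x @[x --> +oo]).
Proof.
by move=> nu0; apply/cvg_ex; eexists; exact: growth_cvg_energy (energyX_cvg nu0).
Qed.

Lemma growth_ge0 nu x : 0 <= nu -> 0 <= x -> 0 <= growth nu x.
Proof.
move=> nu0 x0; rewrite mulr_ge0 ?mulr_ge0 ?powR_ge0 ?expR_ge0//.
by rewrite (le_trans ler01)// P_ge1.
Qed.

Lemma lim_growth_ge0 nu : 0 <= nu -> 0 <= lim (growth nu x @[x --> +oo]).
Proof.
move=> nu0; apply: limr_ge; first exact: growth_is_cvg.
near=> x; apply: growth_ge0 => //; near: x; apply: nbhs_pinfty_ge; exact: num_real.
Unshelve. all: by end_near. Qed.

Lemma amplitude_ge0 nu : 0 <= nu -> 0 <= amplitude nu.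
Proof.
move=> nu0; rewrite divr_ge0 ?lim_growth_ge0// mulr_ge0 ?powR_ge0//.
by rewrite ltW// Gamma_gt0// lerDr.
Qed.

(** [I_(nu+1) / I_nu] tends to [1]. *)
Lemma amplitudeS nu : 0 <= nu -> amplitude (nu + 1) = amplitude nu.
Proof.
move=> nu0; rewrite /amplitude.
have n1 : 1 <= nu + 1 by rewrite lerDr.
have -> : lim (growth (nu + 1) x @[x --> +oo]) =
    (2 * nu + 2) * lim (growth nu x @[x --> +oo]) * 1.
  apply/cvg_lim => //.
  have H : (2 * nu + 2) * growth nu x * (axisQ nu x / axisP nu x) @[x --> +oo] -->
      (2 * nu + 2) * lim (growth nu x @[x --> +oo]) * 1.
    apply: cvgM; last exact: ratio_cvg.
    by apply: cvgM; [exact: cvg_cst|exact: growth_is_cvg].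
  apply: cvg_trans H; apply: near_eq_cvg; near=> x.
  by rewrite growth_next//; near: x; apply: nbhs_pinfty_gt; exact: num_real.
rewrite GammaS// powRD ?pnatr_eq0 ?implybT// powRr1//.
have G0 := Gamma_gt0 n1; have p0 : 0 < 2 `^ nu :> R by rewrite powR_gt0.
by field; rewrite !gt_eqF// ltr_wpDl.
Unshelve. all: by end_near. Qed.

Lemma amplitudeDn nu n : 0 <= nu -> amplitude (nu + n%:R) = amplitude nu.
Proof.
move=> nu0; elim: n => [|n IH]; first by rewrite addr0.
rewrite -natr1 addrA amplitudeS; [exact: IH|exact: addr_ge0].
Qed.

(** The numerator is bounded above by [growth_interpolation] and the denominator
below by [Gamma_interpolation]; the powers of [nu + 1] cancel up to the factor
[1 + 1 / (nu + 1)]. *)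
Lemma amplitude_interpolation nu (d : R) : 0 <= nu -> 0 < d < 1 ->
  amplitude (nu + d) <= amplitude nu * (1 + (nu + 1)^-1).
Proof.
move=> nu0 d01; have /andP[d0 d1] := d01.
have n1 : 1 <= nu + 1 by rewrite lerDr.
have nd0 : 0 <= nu + d by rewrite addr_ge0// ltW.
have nd1 : 1 <= nu + d + 1 by rewrite lerDr.
have k0 : 0 < 2 * nu + 2 by rewrite ltr_wpDl// mulr_ge0.
have np : 0 < nu + 1 by rewrite ltr_wpDl.
have lims : lim (growth (nu + d) x @[x --> +oo]) <=
    (2 * nu + 2) `^ d * lim (growth nu x @[x --> +oo]).
  have H : (2 * nu + 2) `^ d * growth nu x @[x --> +oo] -->
      (2 * nu + 2) `^ d * lim (growth nu x @[x --> +oo]).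
    by apply: cvgM; [exact: cvg_cst|exact: growth_is_cvg].
  rewrite -(cvg_lim _ H)//; apply: ler_lim.
  - exact: growth_is_cvg.
  - by apply/cvg_ex; eexists; exact: H.
  - by near=> x; exact: growth_interpolation.
have G0 := Gamma_gt0 n1; have Gd0 := Gamma_gt0 nd1.
have p0 : 0 < 2 `^ nu :> R by rewrite powR_gt0.
have pd : 0 < 2 `^ d :> R by rewrite powR_gt0.
rewrite /amplitude powRD ?pnatr_eq0 ?implybT// ler_pdivrMr ?mulr_gt0//.
apply: le_trans lims _.
have -> : 2 * nu + 2 = 2 * (nu + 1) by ring.
rewrite powRM ?(ltW np)//.
set l := lim _.
have l0 : 0 <= l by exact: lim_growth_ge0.
move: l l0 => l l0.
have -> : l / (2 `^ nu * Gamma (nu + 1)) * (1 + (nu + 1)^-1) *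
    (2 `^ nu * 2 `^ d * Gamma (nu + d + 1)) =
    2 `^ d * (l * ((1 + (nu + 1)^-1) * Gamma (nu + d + 1) / Gamma (nu + 1))).
  by field; rewrite !gt_eqF.
have -> : 2 `^ d * (nu + 1) `^ d * l = 2 `^ d * (l * (nu + 1) `^ d) by ring.
apply: ler_wpM2l; first exact: ltW.
apply: ler_wpM2l => //; rewrite ler_pdivlMr//.
have := Gamma_interpolation n1 d01; rewrite GammaS// => h.
have -> : nu + d + 1 = nu + 1 + d by ring.
have q0 : 0 <= (nu + 1) `^ d / (nu + 1) by rewrite divr_ge0 ?powR_ge0 ?ltW.
have := ler_wpM2r q0 h.
have -> : (nu + 1) * Gamma (nu + 1) * ((nu + 1) `^ d / (nu + 1)) =
  (nu + 1) `^ d * Gamma (nu + 1) by field; rewrite gt_eqF.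
move=> /le_trans; apply.
rewrite [leRHS]mulrC -!mulrA ler_wpM2l//.
  by rewrite (_ : nu + 1 + d = nu + d + 1) ?ltW//; ring.
have pnd : 0 < (nu + 1) `^ (1 - d) by rewrite powR_gt0.
have -> : (nu + 1) `^ d / (nu + 1) = ((nu + 1) `^ (1 - d))^-1.
  rewrite -powRN opprB powRB ?powRr1 ?(ltW np)//.
  by rewrite (gt_eqF np) implybT.
have -> : (nu + 1 + d) `^ (1 - d) / (nu + 1) `^ (1 - d) =
    ((nu + 1 + d) / (nu + 1)) `^ (1 - d).
  by rewrite powR_div// addr_ge0 ?(ltW np) ?(ltW d0).
have b1 : 1 <= (nu + 1 + d) / (nu + 1) by rewrite ler_pdivlMr// mul1r lerDl ltW.
apply: le_trans (ler1_powR b1 _) _; first by rewrite lerBlDr lerDl ltW.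
rewrite -(@ler_pM2r _ (nu + 1))// divfK ?gt_eqF// mulrDl mul1r mulVf ?gt_eqF//.
by rewrite lerD2l ltW.
Unshelve. all: by end_near. Qed.

(** The correction factor of the interpolation inequality disappears when it is
applied at the orders [nu + n]. *)
Lemma amplitude_le nu (d : R) : 0 <= nu -> 0 <= d < 1 ->
  amplitude (nu + d) <= amplitude nu.
Proof.
move=> nu0 /andP[]; rewrite le_eqVlt => /orP[/eqP <- _|d0 d1]; first by rewrite addr0.
have B0 := amplitude_ge0 nu0.
have H n : amplitude (nu + d) <= amplitude nu + amplitude nu / n.+1%:R.
  have nn : 0 <= nu + n%:R by rewrite addr_ge0.
  have := @amplitude_interpolation (nu + n%:R) d nn.
  rewrite d0 d1 => /(_ isT).
  rewrite (_ : nu + n%:R + d = nu + d + n%:R); last by ring.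
  rewrite !amplitudeDn//; last by rewrite addr_ge0// ltW.
  move=> /le_trans; apply; rewrite mulrDr mulr1 lerD2l ler_wpM2l//.
  rewrite lef_pV2 ?posrE//; last by rewrite ltr_wpDl.
  by rewrite -natr1 lerD2r lerDr.
rewrite leNgt; apply/negP => lt.
pose e := amplitude (nu + d) - amplitude nu.
have e0 : 0 < e by rewrite subr_gt0.
have := H (Num.truncn (amplitude nu / e)).
rewrite -lerBlDl -/e ler_pdivlMr// => h.
have := truncnS_gt (amplitude nu / e); rewrite ltr_pdivrMr// mulrC.
by rewrite ltNge h.
Qed.

(** Both orders can be shifted by integers, so the inequality [amplitude_le]
holds between any two orders, in either direction. *)
Lemma amplitude_const nu mu : 0 <= nu -> 0 <= mu -> amplitude mu = amplitude nu.
Proof.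
suff H (a b : R) : 0 <= a -> 0 <= b -> amplitude b <= amplitude a.
  by move=> nu0 mu0; apply/eqP; rewrite eq_le !H.
move=> a0 b0.
pose n := (Num.truncn a).+1; pose c := b + n%:R - a.
have c0 : 0 <= c by rewrite subr_ge0 ler_wpDl// ltW// truncnS_gt.
have := truncn_itv c0 => /andP[k1 k2].
rewrite -(amplitudeDn n b0).
have -> : b + n%:R = a + (c - (Num.truncn c)%:R) + (Num.truncn c)%:R.
  by rewrite /c; ring.
rewrite amplitudeDn; last by rewrite addr_ge0// subr_ge0.
by apply: amplitude_le => //; rewrite subr_ge0 k1 ltrBlDl natr1.
Qed.

(** At order [1/2] the constant [nu ^ 2 - 1/4] vanishes, so that [g' + 2 g] is
constant. *)
Lemma energyX_half x : 0 < x -> energyX (1 / 2 : R) x 0 = 1.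
Proof.
move=> x0; have h0 : 0 <= 1 / 2 :> R by rewrite divr_ge0.
pose P := axisP (1 / 2 : R); pose Q := axisQ (1 / 2 : R).
pose f y := expR (- y) * (y * (P y + Q y) + P y).
have D (y : R) : has_derive f y 0.
  have Py := P_derive h0 y; have Qy := Q_derive h0 y; have QL := Q_eq h0 y.
  apply: has_derive_eq.
    apply: has_derive_mul; first by deriv.
    apply: has_derive_add; last exact: Py.
    apply: has_derive_mul; first by deriv.
    by apply: has_derive_add; [exact: Py|exact: Qy].
  by rewrite /= /P /Q QL; field.
have fx : f x = 1.
  have := @derive_norm_le _ f (fun=> 0) 0 x 0 (ltW x0) (fun y _ => D y).
  rewrite mul0r => /(_ _) h.
  have {h} : `|f x - f 0| <= 0 by apply: h => y _; rewrite normr0.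
  rewrite normr_le0 subr_eq0 => /eqP ->.
  rewrite /f /P /axisP re_at0; last exact: entire_P.
  by rewrite oppr0 expR0 mul0r add0r mul1r.
transitivity (f x ^+ 2); last by rewrite fx expr1n.
rewrite /energyX /weight /X1 /X2 /rotP1 /rotP2 cos0 sin0 !im_axisE.
rewrite -/(axisP (1 / 2) x) -/(axisQ (1 / 2) x) -/(P x) -/(Q x).
rewrite (_ : 2 * (1 / 2) + 1 = 2%:R); last by field.
rewrite powR_mulrn ?(ltW x0)// (_ : expR (-2 * 1 * x) = expR (- x) ^+ 2).
  by rewrite /f; field; rewrite gt_eqF.
by rewrite -expRM_natl; congr expR; ring.
Qed.

(** The constant is the value of [Gamma (3 / 2)], which contains the Gaussian
integral. *)
Lemma amplitude_half : amplitude (1 / 2 : R) = (Num.sqrt (2 * pi))^-1.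
Proof.
have h0 : 0 <= 1 / 2 :> R by rewrite divr_ge0.
have E : energyX (1 / 2 : R) x 0 @[x --> +oo] --> (1 : R).
  apply: cvg_near_cst; near=> x.
  by apply: energyX_half; near: x; apply: nbhs_pinfty_gt; exact: num_real.
rewrite /amplitude (cvg_lim _ (growth_cvg_energy h0 E))// sqrtr1.
rewrite (_ : 1 / 2 + 1 = 3 / 2 :> R); last by field.
rewrite Gamma_3_2 mul1r powR12_sqrt// sqrtrM//.
have s2 : Num.sqrt 2 != 0 :> R by rewrite gt_eqF// sqrtr_gt0.
have sp : Num.sqrt pi != 0 :> R by rewrite gt_eqF// sqrtr_gt0 pi_gt0.
by field; apply/andP.
Unshelve. all: by end_near. Qed.

Lemma energyX_axis_lim nu : 0 <= nu ->
  energyX nu x 0 @[x --> +oo] --> 2 / pi * (2 `^ nu * Gamma (nu + 1)) ^+ 2.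
Proof.
move=> nu0; have h0 : 0 <= 1 / 2 :> R by rewrite divr_ge0.
have Ec := energyX_cvg nu0; set l := lim _ in Ec.
have l0 : 0 <= l.
  apply: limr_ge => //; near=> x; apply: energyX_ge0.
  by near: x; apply: nbhs_pinfty_gt; exact: num_real.
have G0 : 0 < Gamma (nu + 1) by rewrite Gamma_gt0// lerDr.
have p0 : 0 < 2 `^ nu :> R by rewrite powR_gt0.
have A := amplitude_const h0 nu0.
rewrite amplitude_half /amplitude (cvg_lim _ (growth_cvg_energy nu0 Ec))// in A.
suff <- : l = 2 / pi * (2 `^ nu * Gamma (nu + 1)) ^+ 2 by [].
rewrite -[LHS]sqr_sqrtr//.
have -> : Num.sqrt l = 2 * (Num.sqrt l / 2 / (2 `^ nu * Gamma (nu + 1))) *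
    (2 `^ nu * Gamma (nu + 1)) by field; rewrite !gt_eqF.
rewrite A exprMn exprMn exprVn sqr_sqrtr; last by rewrite mulr_ge0// pi_ge0.
have pi0 : pi != 0 :> R by rewrite gt_eqF// pi_gt0.
by move: (pi : R) pi0 => p pn0; field.
Unshelve. all: by end_near. Qed.

(** The difference between the two axes is [O (1 / r)]. *)
Lemma energyX_imaginary_lim nu : 0 <= nu ->
  energyX nu r (pi / 2) @[r --> +oo] --> 2 / pi * (2 `^ nu * Gamma (nu + 1)) ^+ 2.
Proof.
move=> nu0; have [C C0 HC] := energyX_arc nu0.
have D : energyX nu r (pi / 2) - energyX nu r 0 @[r --> +oo] --> (0 : R).
  apply/norm_cvg0P.
  apply: (squeeze_cvgr (f := fun=> 0) (h := fun r => C / r)).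
  - by near=> r; rewrite normr_ge0 HC.
  - exact: cvg_cst.
  - exact: cvg_div_pinfty.
rewrite -[X in _ --> X]add0r (_ : (fun r => energyX nu r (pi / 2)) =
    (fun r => energyX nu r (pi / 2) - energyX nu r 0 + energyX nu r 0)).
  by apply: cvgD => //; exact: energyX_axis_lim.
by apply/funext => r; rewrite subrK.
Unshelve. all: by end_near. Qed.

End amplitude.

(** * Counting the elements of a discrete unbounded set *)

Section enumeration.
Local Open Scope card_scope.
Context {R : realType}.
Variable Z : set R.
Hypothesis Z_fin : forall y, finite_set [set z | 0 < z <= y /\ Z z].
Hypothesis Z_unbounded : forall y, exists2 z, y < z & Z z.

Lemma seq_min (s : seq R) : s != [::] ->
  exists2 m, m \in s & forall x, x \in s -> m <= x.
Proof.
elim: s => // a s IH _; have [->|/IH [m ms mP]] := eqVneq s [::].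
  by exists a; [rewrite mem_head|move=> x; rewrite inE => /eqP ->].
have [am|ma] := leP a m.
  exists a; first by rewrite mem_head.
  by move=> x; rewrite inE => /predU1P[-> //|/mP]; exact: le_trans.
exists m; first by rewrite inE ms orbT.
by move=> x; rewrite inE => /predU1P[->|/mP//]; exact: ltW.
Qed.

(** A set with finitely many elements in each bounded interval is well
ordered. *)
Lemma next_element y : 0 <= y ->
  exists z, [/\ y < z, Z z & forall x, y < x -> Z x -> z <= x].
Proof.
move=> y0; have [z1 yz1 Zz1] := Z_unbounded y.
have : finite_set [set z | y < z <= z1 /\ Z z].
  apply: sub_finite_set (Z_fin z1) => z /= [/andP[yz zz1] Zz].
  by split=> //; rewrite zz1 (le_lt_trans y0).
move=> /finite_seqP [s sE].
have mem x : x \in s <-> (y < x <= z1 /\ Z x).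
  by have := congr1 (fun A => A x) sE; rewrite /= => ->.
have s0 : s != [::].
  by apply/eqP => s0; have := (mem z1).2; rewrite s0 yz1 lexx => /(_ (conj isT Zz1)).
have [m ms mP] := seq_min s0; have [/andP[ym mz1] Zm] := (mem m).1 ms.
exists m; split=> // x yx Zx; have [xz1|/ltW z1x] := leP x z1.
  by apply: mP; apply/mem; rewrite yx xz1.
exact: le_trans mz1 z1x.
Qed.

(** Each step adds the next element, which increases the count by one. *)
Lemma nth_element n : (0 < n)%N ->
  exists y, [/\ 0 < y, Z y & [set z | 0 < z <= y /\ Z z] #= `I_n].
Proof.
case: n => // n _.
have step (X : {fset R}) y k : 0 <= y -> [set z | 0 < z <= y /\ Z z] = [set` X] ->
    #|` X| = k -> exists y', [/\ 0 < y', Z y' & exists X' : {fset R},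
      [set z | 0 < z <= y' /\ Z z] = [set` X'] /\ #|` X'| = k.+1].
  move=> y0 XE Xk; have [z [yz Zz zP]] := next_element y0.
  have z0 : 0 < z by exact: le_lt_trans yz.
  exists z; split=> //; exists (z |` X)%fset; split; last first.
    rewrite cardfsU1 Xk; have -> // : z \notin X.
    apply/negP => zX; have : [set` X] z by [].
    by rewrite -XE /= => -[/andP[_]]; rewrite leNgt yz.
  rewrite set_fsetU1 -XE; apply/seteqP; split => x /=.
    move=> [/andP[x0 xz] Zx]; have [xy|yx] := leP x y; first by right; rewrite x0.
    by left; apply/eqP; rewrite eq_le xz zP.
  move=> [->|[/andP[x0 xy] Zx]]; first by rewrite z0 lexx.
  by split=> //; rewrite x0 (le_trans xy)// ltW.
elim: n => [|n [y [y0 Zy /esym yn]]].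
  have [|y [y0 Zy [X [XE X1]]]] := step fset0 0 0%N (lexx 0) _ (cardfs0 _).
    rewrite set_fset0; apply/seteqP; split => x //= [/andP[x0 +] _].
    by rewrite leNgt x0.
  by exists y; split=> //; rewrite XE; apply/card_eq_fsetP.
have /finite_fsetP [X XE] := Z_fin y.
have Xn : #|` X| = n.+1 by apply/card_eq_fsetP; rewrite -XE card_eq_sym in yn *.
have [y' [y'0 Zy' [X' [X'E X'n]]]] := step X y n.+1 (ltW y0) XE Xn.
by exists y'; split=> //; rewrite X'E; apply/card_eq_fsetP.
Qed.

(** Fewer than [n] elements lie below [A] as soon as [n] is large. *)
Lemma nth_element_gt A : exists N, forall n y, (N < n)%N ->
  [set z | 0 < z <= y /\ Z z] #= `I_n -> A < y.
Proof.
have /finite_setP [N AN] := Z_fin A; exists N => n y Nn yn.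
rewrite ltNge; apply/negP => yA.
have : [set z | 0 < z <= y /\ Z z] #<= [set z | 0 < z <= A /\ Z z].
  apply: subset_card_le => z /= [/andP[z0 zy] Zz]; split=> //.
  by rewrite z0 (le_trans zy).
by rewrite (card_le_eql yn) (card_le_eqr AN) card_le_II leqNgt Nn.
Qed.

End enumeration.

(** * The Bessel function on the positive axis and its zeros *)

Section imaginary_axis.
Context {R : realType}.
Variable nu : R.
Hypothesis nu0 : 0 <= nu.
Implicit Types y : R.

(** [P] and [- i Q] at [i y]; up to the factor [(y / 2) ^ nu / Gamma (nu + 1)]
these are [J_nu y] and [J_(nu+1) y]. *)
Definition bp y : R := reS (Pcoef nu) y (pi / 2).
Definition bq y : R := imS (Qcoef nu) y (pi / 2).

Lemma cos_even_pihalf n : cos (n.*2%:R * (pi / 2)) = (-1) ^+ n :> R.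
Proof.
elim: n => [|n IH]; first by rewrite mul0r cos0.
rewrite doubleS (_ : _ * _ = n.*2%:R * (pi / 2) + pi); last first.
  by rewrite -addn2 natrD mulrDl; congr (_ + _); field.
by rewrite cosDpi IH exprS mulN1r.
Qed.

Lemma sin_even_pihalf n : sin (n.*2%:R * (pi / 2)) = 0 :> R.
Proof.
elim: n => [|n IH]; first by rewrite mul0r sin0.
rewrite doubleS (_ : _ * _ = n.*2%:R * (pi / 2) + pi); last first.
  by rewrite -addn2 natrD mulrDl; congr (_ + _); field.
by rewrite sinDpi IH oppr0.
Qed.

Lemma cos_odd_pihalf n : cos (n.*2.+1%:R * (pi / 2)) = 0 :> R.
Proof. by rewrite cosSn cos_pihalf mul0r sin_even_pihalf mulr0 subr0. Qed.

Lemma imP_pihalf y : imS (Pcoef nu) y (pi / 2) = 0.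
Proof.
apply: Sum_zero => n; have [on|on] := boolP (odd n).
  by rewrite /Pcoef on !mul0r.
have -> : n = n./2.*2 by rewrite -[LHS]odd_double_half (negbTE on).
by rewrite sin_even_pihalf mulr0.
Qed.

Lemma reQ_pihalf y : reS (Qcoef nu) y (pi / 2) = 0.
Proof.
apply: Sum_zero => n; have [on|on] := boolP (odd n); last first.
  by rewrite /Qcoef (negbTE on) !mul0r.
have -> : n = n./2.*2.+1 by rewrite -[LHS]odd_double_half on.
by rewrite cos_odd_pihalf mulr0.
Qed.

Lemma bp_derive y : has_derive bp y (- bq y).
Proof.
apply: has_derive_eq (P1_radial nu0 _ _) _.
by rewrite cos_pihalf sin_pihalf mul0r mul1r sub0r.
Qed.

Lemma bq_derive y : y != 0 -> has_derive bq y (bp y - (2 * nu + 1) * bq y / y).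
Proof.
move=> yn0; apply: has_derive_eq (Q2_radial nu0 _ yn0) _.
by rewrite cos_pihalf sin_pihalf mul0r mul1r addr0.
Qed.

Lemma bp0 : bp 0 = 1.
Proof. by rewrite /bp re_at0//; exact: entire_P. Qed.

Lemma bp_continuous y : {for y, continuous bp}.
Proof. by apply: has_derive_continuous; exact: bp_derive. Qed.

Lemma bq_continuous y : y != 0 -> {for y, continuous bq}.
Proof. by move=> yn0; apply: has_derive_continuous; exact: bq_derive. Qed.

(** A weighted energy is nondecreasing, so the solution [(bp, bq)] of the
linear system, which is [(1, 0)] at [0], never vanishes. *)
Lemma bpq_gt0 y : 0 < y -> 0 < bp y ^+ 2 + bq y ^+ 2.
Proof.
move=> y0.
have [e [e0 ey pe]] : exists e, [/\ 0 < e, e <= y & 0 < bp e].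
  have /cvgrPdist_lt /(_ 1 ltr01) := @bp_continuous 0.
  rewrite bp0 => /nbhs_ballP [d /= d0 dP].
  exists (Num.min y (d / 2)); split.
  - by rewrite lt_min y0 divr_gt0.
  - by rewrite ge_min lexx.
  - have m0 : 0 < Num.min y (d / 2) by rewrite lt_min y0 divr_gt0.
    have := dP (Num.min y (d / 2)); rewrite /ball/= sub0r normrN gtr0_norm//.
    rewrite gt_min ltr_pdivrMr// ltr_pMr// ltr1n orbT => /(_ isT).
    by rewrite ltr_norml => /andP[_]; rewrite ltrBlDl -ltrBlDr subrr.
pose k := 2 * (2 * nu + 1).
have : e `^ k * (bp e ^+ 2 + bq e ^+ 2) <= y `^ k * (bp y ^+ 2 + bq y ^+ 2).
  apply: (@derive_ge0_le _ (fun t => t `^ k * (bp t ^+ 2 + bq t ^+ 2))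
    (fun t => k * t `^ (k - 1) * bp t ^+ 2)) => // t /andP[et ty].
    have t0 : 0 < t by exact: lt_le_trans et.
    have pt := bp_derive t; have qt := bq_derive (lt0r_neq0 t0).
    apply: has_derive_eq; first by deriv.
    by rewrite (powR_sub1 k t0) /k /=; field; rewrite gt_eqF.
  rewrite mulr_ge0 ?sqr_ge0// mulr_ge0 ?powR_ge0//.
  by rewrite mulr_ge0// addr_ge0// mulr_ge0.
move=> h; rewrite -(pmulr_rgt0 _ (powR_gt0 k y0)).
apply: lt_le_trans h; rewrite mulr_gt0 ?powR_gt0//.
by rewrite ltr_pwDl ?sqr_ge0// exprn_gt0.
Qed.

Lemma bp_neq0 y : 0 < y -> bq y = 0 -> bp y != 0.
Proof.
move=> y0 qy; have := bpq_gt0 y0; rewrite qy expr0n addr0.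
by apply: contraTneq => ->; rewrite expr0n ltxx.
Qed.

Lemma energyX_zero y : 0 < y -> bq y = 0 -> energyX nu y (pi / 2) =
  y `^ (2 * nu + 1) * bp y ^+ 2 * (1 + ((nu + 1 / 2) / y) ^+ 2).
Proof.
move=> y0 qy; rewrite /energyX /weight /X1 /X2 /rotP1 /rotP2.
rewrite imP_pihalf reQ_pihalf -/(bp y) -/(bq y) qy cos_pihalf sin_pihalf.
by rewrite mulr0 mul0r expR0; field; rewrite gt_eqF.
Qed.

(** Sturm comparison of [y ^ (nu + 1/2) * bq y] with [sin ((y - y0) / 2)]. *)
Lemma bq_oscillates y0 : 0 < y0 -> 2 * ((nu + 1 / 2) ^+ 2 + (nu + 1 / 2)) <= y0 ^+ 2 ->
  exists2 z, y0 <= z & bq z = 0.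
Proof.
move=> y00 hy0; apply: contrapT => noz.
have qn0 z : y0 <= z -> bq z != 0.
  by move=> yz; apply/eqP => qz; apply: noz; exists z.
pose s := bq y0; pose y1 := y0 + 2 * pi; pose a := nu + 1 / 2.
have y01 : y0 <= y1 by rewrite lerDl mulr_ge0// pi_ge0.
have pos z : y0 <= z -> 0 < z by exact: lt_le_trans.
have sq z : y0 <= z -> 0 < s * bq z.
  move=> yz; rewrite ltNge; apply/negP => sz.
  have cq : {within `[y0, z], continuous bq}.
    apply: (@has_derive_within _ _ (fun t => bp t - (2 * nu + 1) * bq t / t)).
    by move=> t /andP[/pos t0 _]; apply: bq_derive; rewrite gt_eqF.
  have [|c] := @IVT R bq y0 z 0 yz cq.
    rewrite ge_min le_max; move: sz; rewrite /s.
    have := qn0 _ (lexx y0); move: (bq y0) (bq z) => u v u0.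
    have [u1|u1] := ltP 0 u.
      by rewrite pmulr_rle0// => v0; rewrite v0 (ltW u1) orbT.
    have u2 : u < 0 by rewrite lt_neqAle u0.
    by rewrite nmulr_rle0// => v0; rewrite v0 ?u1 ?orbT.
  by rewrite in_itv/= => /andP[yc _] qc; have := qn0 _ yc; rewrite qc eqxx.
pose w t : R := sin ((t - y0) / 2); pose dw t : R := cos ((t - y0) / 2) / 2.
(* [G] is [s] times the Wronskian of [h = t ^ a * bq t] and [w]. As
   [h'' = ((a ^ 2 + a) / t ^ 2 - 1) h] and [w'' = - w / 4], its derivative is
   [- s (3 / 4 - (a ^ 2 + a) / t ^ 2) h w]. On the arch of the sine from [y0] to [y1],
   where [s h w >= 0], it is nonpositive, but [G] is negative at [y0] and
   positive at [y1] *)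
pose G t := s * (t `^ a * ((bp t - a / t * bq t) * w t - bq t * dw t)).
have : G y1 <= G y0.
  apply: (@derive_le0_ge _ G (fun t =>
    - ((3 / 4 - (a ^+ 2 + a) / t ^+ 2) * (t `^ a * w t) * (s * bq t)))) => //.
    move=> t /andP[/pos t0 _].
    have pt := bp_derive t; have qt := bq_derive (lt0r_neq0 t0).
    rewrite /G /w /dw; apply: has_derive_eq; first by deriv; rewrite ?gt_eqF.
    by rewrite (powR_sub1 a t0) /a /=; field; rewrite gt_eqF.
  move=> t /andP[yt ty1]; have t0 := pos _ yt; rewrite oppr_le0.
  apply: mulr_ge0; last by rewrite ltW// sq.
  apply: mulr_ge0.
    rewrite subr_ge0 ler_pdivrMr ?exprn_gt0//.
    have : y0 ^+ 2 <= t ^+ 2 by rewrite lerXn2r// nnegrE ltW.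
    have := sqr_ge0 t; rewrite -/a in hy0; lra.
  rewrite mulr_ge0 ?powR_ge0// sin_ge0_pi// divr_ge0 ?subr_ge0//=.
  by rewrite ler_pdivrMr// lerBlDl mulrC.
have e0 : G y0 = - (y0 `^ a * (s * bq y0) / 2).
  by rewrite /G /w /dw subrr mul0r sin0 cos0; field; rewrite gt_eqF.
have e1 : G y1 = y1 `^ a * (s * bq y1) / 2.
  have h : (y1 - y0) / 2 = pi by rewrite /y1; field.
  by rewrite /G /w /dw h sinpi cospi; field; rewrite gt_eqF// pos.
rewrite e0 e1 => h.
have h1 : 0 < y1 `^ a * (s * bq y1) / 2 by rewrite divr_gt0// mulr_gt0 ?powR_gt0 ?sq ?pos.
have h0 : 0 < y0 `^ a * (s * bq y0) / 2 by rewrite divr_gt0// mulr_gt0 ?powR_gt0 ?sq ?pos.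
have := lt_le_trans h1 h; rewrite oppr_gt0 ltNge (ltW h0)//.
Qed.

Lemma bq_unbounded y : exists2 z, y < z & (0 < z) && (bq z == 0).
Proof.
pose c := 2 * ((nu + 1 / 2) ^+ 2 + (nu + 1 / 2)).
have c0 : 0 <= c by rewrite mulr_ge0// addr_ge0 ?sqr_ge0// addr_ge0.
pose y0 := `|y| + c + 1.
have y01 : 1 <= y0 by rewrite lerDr addr_ge0.
have y00 : 0 < y0 by exact: lt_le_trans y01.
have [|z yz qz] := bq_oscillates y00.
  apply: (@le_trans _ _ y0); first by rewrite /y0 -/c -addrA addrCA lerDl addr_ge0.
  by rewrite expr2 ler_peMl// ltW.
have yy : y < y0.
  by rewrite (le_lt_trans (ler_norm y))// /y0 -addrA ltrDl ltr_wpDl.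
exists z; first exact: lt_le_trans yz.
by rewrite (lt_le_trans y00)//= qz.
Qed.

(** [J_(nu+1)] can be computed from [Q] at order [nu] and from [P] at order
[nu + 1]; the second form shows that the zero at [0] is simple. *)
Lemma bq_next y : bq y = y / (2 * nu + 2) * reS (Pcoef (nu + 1)) y (pi / 2).
Proof.
rewrite /bq imS_unshift//; first by
  rewrite unshift_Q_axis// cos_pihalf sin_pihalf mul1r mul0r addr0 mulrA.
exact: entire_Q.
Qed.

End imaginary_axis.

Section zeros.
Context {R : realType}.
Variable nu : R.
Hypothesis nu0 : 0 <= nu.
Implicit Types y : R.

Let nu1 : 0 <= nu + 1. Proof. by rewrite addr_ge0. Qed.

Lemma isolated_zero (f : R -> R) (x d : R) : has_derive f x d -> d != 0 ->
  f x = 0 -> exists2 e, 0 < e & forall y, y != x -> `|y - x| < e -> f y != 0.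
Proof.
move=> [/cvg_ex[/= l fl] fd] d0 fx0.
have ld : l = d by rewrite -fd; apply/esym/cvg_lim.
have : \forall h \near 0^', h^-1 *: (f (h *: 1 + x) - f x) != 0.
  by apply: (cvgr_neq0 _ fl); rewrite ld.
move=> /nbhs_ballP [e /= e0 eP]; exists e => // y yx yxe.
have := eP (y - x); rewrite /ball/= sub0r normrN => /(_ yxe).
rewrite subr_eq0 => /(_ yx); apply: contraNneq => fy.
by rewrite fx0 [_ *: 1]mulr1 subrK fy subrr scaler0.
Qed.

(** At a positive zero the derivative of [bq] is [bp], which does not vanish
there. *)
Lemma bq_simple_zero y : 0 <= y -> bq nu y = 0 ->
  exists2 d, has_derive (bq nu) y d & d != 0.
Proof.
rewrite le_eqVlt => /orP[/eqP <- _|y0 qy].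
  exists ((2 * nu + 2)^-1); last by rewrite invr_eq0 gt_eqF// ltr_wpDl// mulr_ge0.
  have -> : bq nu = (fun t => t * (2 * nu + 2)^-1 * bp (nu + 1) t).
    by apply/funext => t; exact: bq_next.
  have p1 := bp_derive nu1 0.
  apply: has_derive_eq; first by deriv.
  by rewrite /= bp0//; ring.
exists (bp nu y); last exact: bp_neq0.
apply: has_derive_eq (bq_derive nu0 (lt0r_neq0 y0)) _.
by rewrite qy mulr0 mul0r subr0.
Qed.

(** Otherwise the zeros would have a limit point, which would be a zero that is
not isolated. The limit point may be [0], which is why [bq_simple_zero]
includes [0]. *)
Lemma bq_zeros_finite y : finite_set [set z | 0 < z <= y /\ bq nu z = 0].
Proof.
apply: contrapT => infE.
have [|x xP] := infinite_bounded_limit_point_nonempty infE.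
  exists y; split; first exact: num_real.
  by move=> M yM z [/andP[z0 zy] _] /=; rewrite gtr0_norm// (le_trans zy)// ltW.
have [x0|x0] := ltP x 0.
  have [z [_ [/andP[z0 _] _] /= zx]] := xP _ (lt_nbhsl x0).
  by move: z0; rewrite ltNge ltW.
have [qx|qx] := eqVneq (bq nu x) 0.
  have [d dq d0] := bq_simple_zero x0 qx.
  have [e e0 eP] := isolated_zero dq d0 qx.
  have [z [zx [_ qz]]] := xP _ (nbhsx_ballx x e e0).
  rewrite /ball/= distrC => zxe; have := eP z zx zxe.
  by rewrite qz eqxx.
have xn0 : x != 0.
  by apply: contraNneq qx => ->; rewrite bq_next// !mul0r.
have U : \forall z \near x, bq nu z != 0.
  have c : bq nu z @[z --> x] --> bq nu x by exact: (bq_continuous nu0 xn0).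
  exact: (cvgr_neq0 _ c qx).
by have [z [_ [_ qz] /=]] := xP _ U; rewrite qz eqxx.
Qed.

(** The recursion of the coefficients is the functional equation of Gamma and of
the factorial. *)
Lemma tcoef_Gamma n : tcoef nu n.*2 =
  Gamma (nu + 1) / (n`!%:R * Gamma (n%:R + nu + 1) * 2 ^+ n.*2).
Proof.
have G0 : Gamma (nu + 1) != 0 by rewrite gt_eqF// Gamma_gt0// lerDr.
elim: n => [|n IH].
  by rewrite /= fact0 expr0 add0r mul1r mulr1 divff.
rewrite doubleS tcoefSS IH factS natrM !exprS.
have n0 : 0 <= n%:R :> R by [].
have n1 : 1 <= n%:R + nu + 1 :> R by rewrite lerDr addr_ge0.
have -> : n.+1%:R + nu + 1 = n%:R + nu + 1 + 1 :> R by rewrite -natr1; ring.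
rewrite (GammaS n1); have Gn := Gamma_gt0 n1; have f0 := fact_gt0 n.
have e1 : n.*2.+1%:R = 2 * n%:R + 1 :> R by rewrite -addn1 natrD -mul2n natrM.
have e2 : n.*2.+2%:R = 2 * n%:R + 2 :> R by rewrite -addn2 natrD -mul2n natrM.
have e3 : n.+1%:R = n%:R + 1 :> R by rewrite natr1.
rewrite e1 e2 e3.
have f1 : n`!%:R != 0 :> R by rewrite pnatr_eq0 -lt0n.
have p0 : 2 ^+ n.*2 != 0 :> R by rewrite expf_neq0.
move: (n`!%:R : R) (2 ^+ n.*2 : R) (n%:R : R) f1 p0 n0 Gn n1 => f p m f1 p0 m0.
move: (Gamma (m + nu + 1)) => g g0 _.
field; rewrite f1 p0 (gt_eqF g0) /=.
by have h := nu0; apply/and4P; split; rewrite gt_eqF//; lra.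
Qed.

(** At the angle [pi / 2] the power [z ^ (2 m)] gives the sign [(-1) ^ m]. *)
Lemma besselJ_bp y : 0 < y ->
  besselJ nu y = (y / 2) `^ nu / Gamma (nu + 1) * bp nu y.
Proof.
move=> y0; have y2 : 0 < y / 2 by rewrite divr_gt0.
rewrite /bp /reS; have eP := entire_P nu0.
have sP := summable_re (r := y) (theta := pi / 2) eP.
have z1 n : Pcoef nu n.*2.+1 * y ^+ n.*2.+1 * cos (n.*2.+1%:R * (pi / 2)) = 0.
  by rewrite /Pcoef/= odd_double !mul0r.
rewrite (Sum_even sP z1) -(Sum_scale _ (summable_even sP z1)).
rewrite /besselJ /Sum; congr (limn (series _)); apply/funext => m.
rewrite cos_even_pihalf /Pcoef odd_double tcoef_Gamma.
have -> : (y / 2) `^ (2 * m%:R + nu) = (y / 2) ^+ m.*2 * (y / 2) `^ nu.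
  rewrite powRD; last by rewrite (gt_eqF y2) implybT.
  by rewrite -natrM mul2n powR_mulrn// ltW.
have G0 : Gamma (nu + 1) != 0 by rewrite gt_eqF// Gamma_gt0// lerDr.
have Gm : Gamma (m%:R + nu + 1) != 0 by rewrite gt_eqF// Gamma_gt0// lerDr addr_ge0.
have f1 : m`!%:R != 0 :> R by rewrite pnatr_eq0 -lt0n fact_gt0.
have p0 : 2 ^+ m.*2 != 0 :> R by rewrite expf_neq0.
rewrite expr_div_n.
move: (m`!%:R : R) (2 ^+ m.*2 : R) (Gamma (m%:R + nu + 1)) f1 p0 Gm => f p g f1 p0 g0.
by field; rewrite f1 p0 g0 G0.
Qed.

End zeros.

Section nth_zero.
Context {R : realType}.
Variable nu : R.
Hypothesis nu0 : 0 <= nu.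
Local Open Scope card_scope.

Let nu1 : 0 <= nu + 1. Proof. by rewrite addr_ge0. Qed.

Lemma besselJ_next_eq0 (y : R) : 0 < y ->
  besselJ (nu + 1) y = 0 <-> bq nu y = 0.
Proof.
move=> y0; rewrite besselJ_bp// bq_next// -/(bp (nu + 1) y).
have k1 : (y / 2) `^ (nu + 1) / Gamma (nu + 1 + 1) != 0.
  by rewrite gt_eqF// divr_gt0 ?powR_gt0 ?divr_gt0// Gamma_gt0// lerDr.
have k2 : y / (2 * nu + 2) != 0.
  by rewrite gt_eqF// divr_gt0// ltr_wpDl// mulr_ge0.
split => /eqP; rewrite mulf_eq0; first by rewrite (negbTE k1) => /eqP ->; rewrite mulr0.
by rewrite (negbTE k2) => /eqP ->; rewrite mulr0.
Qed.

Lemma zeros_eq (y : R) : [set z | 0 < z <= y /\ besselJ (nu + 1) z = 0] =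
  [set z | 0 < z <= y /\ bq nu z = 0].
Proof.
by apply/seteqP; split => z /= [/andP[z0 zy] /(besselJ_next_eq0 z0) qz];
  rewrite z0 zy.
Qed.

(** The chosen value satisfies its specification because an [n]-th zero
exists. *)
Lemma besselJ_zeroP n : (0 < n)%N ->
  is_nth_pos_zero (besselJ (nu + 1)) n (besselJ_zero (nu + 1) n).
Proof.
move=> n0; have unb y : exists2 z, y < z & bq nu z = 0.
  by have [z yz /andP[_ /eqP qz]] := bq_unbounded nu0 y; exists z.
have [y [y0 qy yn]] := nth_element (bq_zeros_finite nu0) unb n0.
apply: (xgetPex 0); exists y; split=> //; first exact/besselJ_next_eq0.
by rewrite zeros_eq.
Qed.

Lemma besselJ_zero_gt0 n : (0 < n)%N -> 0 < besselJ_zero (nu + 1) n.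
Proof. by move=> /besselJ_zeroP []. Qed.

Lemma bq_besselJ_zero n : (0 < n)%N -> bq nu (besselJ_zero (nu + 1) n) = 0.
Proof. by move=> /besselJ_zeroP [j0 q _]; exact/besselJ_next_eq0. Qed.

Lemma besselJ_zero_cvgy : besselJ_zero (nu + 1) n @[n --> \oo] --> +oo.
Proof.
apply/cvgryPge => A.
have [N NP] := nth_element_gt (bq_zeros_finite nu0) A.
near=> n; apply/ltW/(NP n); first by near: n; exact: nbhs_infty_gt.
have /besselJ_zeroP [_ _] : (0 < n)%N by near: n; exact: nbhs_infty_gt.
by rewrite zeros_eq.
Unshelve. all: by end_near. Qed.

(** At a zero of [J_(nu+1)] the energy is [J_nu ^ 2] up to normalisation, so its
limit gives the size of [J_nu] there. *)
Lemma bp_at_zeros_lim :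
  besselJ_zero (nu + 1) n `^ (2 * nu + 1) * bp nu (besselJ_zero (nu + 1) n) ^+ 2
    @[n --> \oo] --> 2 / pi * (2 `^ nu * Gamma (nu + 1)) ^+ 2.
Proof.
pose j n := besselJ_zero (nu + 1) n; pose a := nu + 1 / 2.
have E : energyX nu (j n) (pi / 2) @[n --> \oo] -->
    2 / pi * (2 `^ nu * Gamma (nu + 1)) ^+ 2.
  exact: (@cvg_comp _ _ _ j (fun r => energyX nu r (pi / 2)) _ _ _
    besselJ_zero_cvgy (energyX_imaginary_lim nu0)).
have aj : a / j n @[n --> \oo] --> (0 : R).
  exact: (@cvg_comp _ _ _ j (fun r => a / r) _ _ _
    besselJ_zero_cvgy (cvg_div_pinfty a)).
have D : 1 + (a / j n) * (a / j n) @[n --> \oo] --> (1 : R).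
  rewrite -[X in _ --> X]addr0 -[X in _ --> _ + X](mulr0 (0 : R)).
  by apply: cvgD; [exact: cvg_cst|exact: cvgM].
have H : energyX nu (j n) (pi / 2) * (1 + (a / j n) * (a / j n))^-1 @[n --> \oo] -->
    2 / pi * (2 `^ nu * Gamma (nu + 1)) ^+ 2 * 1^-1.
  by apply: cvgM => //; apply: cvgV => //; exact: oner_neq0.
rewrite invr1 mulr1 in H; apply: cvg_trans H; apply: near_eq_cvg; near=> n.
have n0 : (0 < n)%N by near: n; exact: nbhs_infty_gt.
rewrite energyX_zero ?besselJ_zero_gt0 ?bq_besselJ_zero// -expr2 mulfK//.
by rewrite gt_eqF// ltr_pwDl// sqr_ge0.
Unshelve. all: by end_near. Qed.

End nth_zero.

(** * The normalised eigenfunctions *)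

Section eigenfunctions.
Context {R : realType}.
Variable alpha : R.
Hypothesis halpha : 1 <= alpha < 2.
Local Opaque Gamma.

Let nu : R := nu_ alpha.
Let kappa : R := (2 - alpha) / 2.
Let mu := @lebesgue_measure R.

Lemma alpha_lt2 : 0 < 2 - alpha.
Proof. by move: halpha => /andP[_ h]; rewrite subr_gt0. Qed.

Lemma nu_ge0 : 0 <= nu.
Proof.
move: halpha => /andP[h1 _].
by rewrite divr_ge0 ?subr_ge0//; move: alpha_lt2; rewrite subr_gt0 => /ltW.
Qed.

Lemma kappa_gt0 : 0 < kappa.
Proof. by rewrite divr_gt0// alpha_lt2. Qed.

Lemma kappa_lt1 : kappa < 1.
Proof. by move: halpha => /andP[h1 _]; rewrite ltr_pdivrMr//; lra. Qed.

Lemma nu_kappa : nu = (2 * kappa)^-1 - 1.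
Proof. by rewrite /nu /nu_ /kappa; field; rewrite gt_eqF// alpha_lt2. Qed.

Lemma cplus0_gt0 : 0 < cplus0 nu.
Proof.
by rewrite divr_gt0// mulr_gt0 ?powR_gt0// Gamma_gt0// lerDr nu_ge0.
Qed.

Section fixed_zero.
Variable j : R.
Hypothesis j0 : 0 < j.
Hypothesis qj : bq nu j = 0.

Let c := cplus0 nu * j `^ nu.

Let c_gt0 : 0 < c. Proof. by rewrite mulr_gt0 ?cplus0_gt0// powR_gt0. Qed.

(** The factor [x ^ ((1 - alpha) / 2)] is cancelled by [(j x ^ kappa) ^ nu]. *)
Lemma besselJ_profile (x : R) : 0 < x ->
  x `^ ((1 - alpha) / 2) * besselJ nu (j * x `^ kappa) =
  c * bp nu (j * x `^ kappa).
Proof.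
move=> x0; have xk : 0 < x `^ kappa by rewrite powR_gt0.
rewrite besselJ_bp; [|exact: nu_ge0|exact: mulr_gt0].
have -> : (j * x `^ kappa / 2) `^ nu = j `^ nu * x `^ (kappa * nu) / 2 `^ nu.
  rewrite powR_div//; last by rewrite mulr_ge0// ltW.
  by rewrite powRM; [rewrite -powRrM|exact: ltW|exact: ltW].
have -> : kappa * nu = - ((1 - alpha) / 2).
  by rewrite nu_kappa /kappa; field; rewrite gt_eqF// alpha_lt2.
rewrite powRN /c /cplus0.
have h1 : x `^ ((1 - alpha) / 2) != 0 by rewrite gt_eqF// powR_gt0.
have h2 : 2 `^ nu != 0 :> R by rewrite gt_eqF// powR_gt0.
have h3 : Gamma (nu + 1) != 0 by rewrite gt_eqF// Gamma_gt0// lerDr nu_ge0.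
move: (x `^ _) (2 `^ nu) (Gamma _) h1 h2 h3 => u v g h1 h2 h3.
by field; rewrite h1 h2 h3.
Qed.

Let p (x : R) := bp nu (j * x `^ kappa).
Let q (x : R) := bq nu (j * x `^ kappa).

Let power_cvg0 : j * x `^ kappa @[x --> 0^'+] --> (0 : R).
Proof.
rewrite -[X in _ --> X](mulr0 j); apply: cvgM; first exact: cvg_cst.
by apply: powR_cvg0; exact: kappa_gt0.
Qed.

Let p_cvg0 : p x @[x --> 0^'+] --> (1 : R).
Proof.
rewrite -(bp0 nu_ge0); apply: cvg_comp power_cvg0 _.
exact: (bp_continuous nu_ge0).
Qed.

Let q_cvg0 : q x @[x --> 0^'+] --> (0 : R).
Proof.
have bq_cont : {for 0, continuous (bq nu)}.
  have q0 : bq nu 0 = 0 by rewrite (bq_next nu_ge0) !mul0r.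
  have [d dq _] := bq_simple_zero nu_ge0 (lexx 0) q0.
  exact: has_derive_continuous dq.
have := @cvg_comp _ _ _ (fun x => j * x `^ kappa) (bq nu) _ _ _ power_cvg0 bq_cont.
by rewrite (bq_next nu_ge0) !mul0r.
Qed.

Let p_derive (x : R) : 0 < x ->
  has_derive p x (- q x * (j * (kappa * (x `^ kappa / x)))).
Proof.
move=> x0; apply: has_derive_comp; first exact: (bp_derive nu_ge0).
apply: has_derive_eq; first by deriv.
by rewrite powR_sub1//=; ring.
Qed.

Let q_derive (x : R) : 0 < x -> has_derive q x
  ((p x - (2 * nu + 1) * q x / (j * x `^ kappa)) * (j * (kappa * (x `^ kappa / x)))).
Proof.
move=> x0; have xk : 0 < x `^ kappa by rewrite powR_gt0.
apply: has_derive_comp.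
  by apply: (bq_derive nu_ge0); rewrite gt_eqF// mulr_gt0.
apply: has_derive_eq; first by deriv.
by rewrite powR_sub1//=; ring.
Qed.

(** Lommel's antiderivative of [y * J_nu y ^ 2], in the variable
[y = j * x ^ kappa]. *)
Let F (x : R) := kappa^-1 *
  (x * (p x ^+ 2 + q x ^+ 2) / 2 - nu / j * (x `^ (1 - kappa) * (p x * q x))).

Let F_derive (x : R) : 0 < x -> has_derive F x (p x ^+ 2).
Proof.
move=> x0; have xk : 0 < x `^ kappa by rewrite powR_gt0.
have dp := p_derive x0; have dq := q_derive x0.
rewrite /F; apply: has_derive_eq; first by deriv.
have -> : x `^ (1 - kappa - 1) = (x `^ kappa)^-1 by rewrite addrAC subrr sub0r powRN.
have -> : x `^ (1 - kappa) = x / x `^ kappa.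
  by rewrite powRB ?powRr1 ?(ltW x0)// (gt_eqF x0) implybT.
have k0 := kappa_gt0; rewrite nu_kappa /=.
move: (p x) (q x) kappa xk k0 => P Q k xk k0.
by field; rewrite !gt_eqF.
Qed.

Let p_continuous (x : R) : 0 < x -> {for x, continuous p}.
Proof. by move=> x0; apply: has_derive_continuous; exact: p_derive. Qed.

Let x0_powR : (0 : R) `^ kappa = 0.
Proof. by rewrite powR0// gt_eqF// kappa_gt0. Qed.

(** [F] vanishes at [0], and at [1] only the term in [p ^ 2] remains because
[q 1 = bq nu j = 0]. *)
Lemma integral_profile :
  (\int[mu]_(x in `[0%R, 1%R]) ((bp nu (j * x `^ kappa)) ^+ 2)%:E)%E =
  (bp nu j ^+ 2 / (2 * kappa))%:E.
Proof.
have p0 : p 0 = 1 by rewrite /p x0_powR mulr0 (bp0 nu_ge0).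
have F0 : F 0 = 0.
  rewrite /F [X in _ - X](_ : _ = 0) ?mul0r ?subr0 ?mulr0//.
  by rewrite powR0 ?mul0r ?mulr0// gt_eqF// subr_gt0 kappa_lt1.
have F1 : F 1 = bp nu j ^+ 2 / (2 * kappa).
  rewrite /F /p /q !powR1 !mulr1 qj; field.
  by rewrite !gt_eqF ?kappa_gt0.
have Fcvg0 : F x @[x --> 0^'+] --> F 0.
  have idc : x @[x --> (0 : R)^'+] --> (0 : R).
    by apply: cvg_at_right_filter; exact: cvg_id.
  have k1 : 0 < 1 - kappa by rewrite subr_gt0 kappa_lt1.
  have H1 : x * (p x ^+ 2 + q x ^+ 2) / 2 @[x --> 0^'+] --> (0 * (1 * 1 + 0 * 0) / 2 : R).
    under eq_fun do rewrite !expr2.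
    apply: cvgM; last exact: cvg_cst.
    by apply: cvgM => //; apply: cvgD; exact: cvgM.
  have H2 : nu / j * (x `^ (1 - kappa) * (p x * q x)) @[x --> 0^'+] -->
      (nu / j * (0 * (1 * 0)) : R).
    apply: cvgM; first exact: cvg_cst.
    by apply: cvgM; [exact: powR_cvg0|exact: cvgM].
  have := cvgM (cvg_cst kappa^-1) (cvgB H1 H2).
  by rewrite F0 !mul0r !mulr0 subr0 mulr0; apply.
rewrite (@continuous_FTC2 R (fun x => p x ^+ 2) F 0 1 ltr01).
- by rewrite F1 F0 -EFinB subr0.
- apply/continuous_within_itvP; first exact: ltr01.
  split.
  + move=> x; rewrite in_itv/= => /andP[x0 _].
    rewrite (_ : (fun x => p x ^+ 2) = (fun x => p x * p x)); last first.
      by apply/funext => y; rewrite expr2.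
    by apply: continuousM; exact: p_continuous.
  + rewrite p0 expr1n -[X in _ --> X](mulr1 1).
    by under eq_fun do rewrite expr2; exact: cvgM.
  + apply: cvg_at_left_filter; under eq_fun do rewrite expr2; rewrite expr2.
    by apply: cvgM; exact: p_continuous.
- split; [|exact: Fcvg0|].
  + by move=> x; rewrite in_itv/= => /andP[/F_derive [? _] _].
  + by apply: cvg_at_left_filter; apply: has_derive_continuous; exact: F_derive.
- by move=> x; rewrite in_itv/= => /andP[/F_derive [_ Fx] _]; rewrite derive1E.
Qed.

Lemma integral_profile_oo (k : R) : 0 <= k ->
  (\int[mu]_(x in `]0%R, 1%R[) (k * bp nu (j * x `^ kappa) ^+ 2)%:E)%E =
  (k * (bp nu j ^+ 2 / (2 * kappa)))%:E.
Proof.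
move=> k0; rewrite EFinM -integral_profile.
have mp : measurable_fun (`]0%R, 1%R[ : set R) (fun x : R => (bp nu (j * x `^ kappa)) ^+ 2).
  apply: open_continuous_measurable_fun; first exact: interval_open.
  move=> x /set_mem /=; rewrite in_itv/= => /andP[x0 _].
  exact: has_derive_continuous (has_derive_exp 2 (p_derive x0)).
have mp' : measurable_fun (`]0%R, 1%R[ : set R)
    (fun x : R => ((bp nu (j * x `^ kappa)) ^+ 2)%:E) by exact/measurable_EFinP.
rewrite (integral_itv_bndoo _ _ mp') -ge0_integralZl_EFin//.
by move=> x _; rewrite lee_fin sqr_ge0.
Qed.

Lemma profile_norm (K : R) : 0 < K ->
  L2norm01 (fun x => K * (x `^ ((1 - alpha) / 2) * besselJ nu (j * x `^ kappa))) =
  (K * c * `|bp nu j| / Num.sqrt (2 - alpha))%:E.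
Proof.
move=> K0; have a2 := alpha_lt2.
have k2 : 2 * kappa = 2 - alpha by rewrite /kappa; field.
pose g (x : R) : R := K * (x `^ ((1 - alpha) / 2) * besselJ nu (j * x `^ kappa)).
pose f (x : R) : R := (K * c) ^+ 2 * bp nu (j * x `^ kappa) ^+ 2.
have E : (\int[mu]_x (`|(EFin \o (g \_ `]0%R, 1%R[)) x| `^ 2))%E =
    ((K * c) ^+ 2 * (bp nu j ^+ 2 / (2 - alpha)))%:E.
  transitivity (\int[mu]_(x in `]0%R, 1%R[) (f x)%:E)%E.
    rewrite [RHS]integral_mkcond; apply: eq_integral => x _.
    rewrite /= !patchE; case: ifPn => xI.
      rewrite powR_mulrn// real_normK ?num_real//.
      rewrite /g besselJ_profile; last by move: xI => /set_mem /=; rewrite in_itv/= => /andP[].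
      by rewrite /f; congr EFin; ring.
    by rewrite /point/= normr0 powR0.
  by rewrite integral_profile_oo ?sqr_ge0// k2.
rewrite /L2norm01 unlock -/g E poweR_EFin; congr EFin.
rewrite powR12_sqrt; last first.
  by rewrite mulr_ge0 ?sqr_ge0// divr_ge0 ?sqr_ge0// ltW.
rewrite sqrtrM ?sqr_ge0// sqrtr_sqr ger0_norm; last by rewrite mulr_ge0// ltW.
by rewrite sqrtrM ?sqr_ge0// sqrtr_sqr sqrtrV ?mulrA// ltW.
Qed.

Lemma profile_at0 : (fun x : R => x `^ ((1 - alpha) / 2) *
    besselJ nu (j * x `^ kappa)) x @[x --> 0^'+] --> c.
Proof.
have H : c * p x @[x --> 0^'+] --> c * 1 by apply: cvgM; [exact: cvg_cst|].
rewrite mulr1 in H; apply: cvg_trans H; apply: near_eq_cvg; near=> x.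
by rewrite /= besselJ_profile.
Unshelve. all: by end_near. Qed.

Lemma profile_at1 : (fun x : R => x `^ ((1 - alpha) / 2) *
    besselJ nu (j * x `^ kappa)) x @[x --> 1^'-] --> c * bp nu j.
Proof.
have H : c * p x @[x --> 1^'-] --> c * p 1.
  apply: cvgM; first exact: cvg_cst.
  by apply: cvg_at_left_filter; exact: p_continuous.
rewrite [p 1](_ : _ = bp nu j) in H; last by rewrite /p powR1 mulr1.
apply: cvg_trans H; apply: near_eq_cvg; near=> x.
rewrite /= besselJ_profile//; near: x; exact: nbhs_left_gt.
Unshelve. all: by end_near. Qed.

End fixed_zero.

Local Notation j n := (besselJ_zero (nu + 1) n).
Local Notation c n := (cplus0 nu * j n `^ nu).

(** The normalising constant is the only positive [K] for which the norm computed
in [profile_norm] is [1]. *)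
Lemma K_eq n : (0 < n)%N ->
  K_ alpha n = Num.sqrt (2 - alpha) / (c n * `|bp nu (j n)|).
Proof.
move=> n0; have j0 := besselJ_zero_gt0 nu_ge0 n0.
have qj := bq_besselJ_zero nu_ge0 n0.
have pj : 0 < `|bp nu (j n)| by rewrite normr_gt0 (bp_neq0 nu_ge0).
have c0 : 0 < c n by rewrite mulr_gt0 ?cplus0_gt0// powR_gt0.
have s0 : 0 < Num.sqrt (2 - alpha) by rewrite sqrtr_gt0 alpha_lt2.
have normE := profile_norm j0 qj.
apply: xget_unique.
  have K0 : 0 < Num.sqrt (2 - alpha) / (c n * `|bp nu (j n)|).
    by rewrite divr_gt0// mulr_gt0.
  split=> //=; rewrite [LHS](normE _ K0); congr EFin.
  move: (c n) `|bp nu (j n)| (Num.sqrt _) c0 pj s0 => u v w u0 v0 w0.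
  by field; rewrite !gt_eqF.
move=> K [K0 /=]; rewrite [X in X = _ -> _](normE _ K0) => -[h].
move: (c n) `|bp nu (j n)| (Num.sqrt _) c0 pj s0 h => u v w u0 v0 w0 h.
rewrite -[RHS]mul1r -h; field; rewrite !gt_eqF//.
Qed.

Lemma Phi_cvg0 n : (0 < n)%N ->
  Phi alpha n x @[x --> 0^'+] --> Num.sqrt (2 - alpha) / `|bp nu (j n)|.
Proof.
move=> n0; have j0 := besselJ_zero_gt0 nu_ge0 n0.
have qj := bq_besselJ_zero nu_ge0 n0.
have pj : 0 < `|bp nu (j n)| by rewrite normr_gt0 (bp_neq0 nu_ge0).
have c0 : 0 < c n by rewrite mulr_gt0 ?cplus0_gt0// powR_gt0.
have -> : Num.sqrt (2 - alpha) / `|bp nu (j n)| = K_ alpha n * c n.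
  rewrite K_eq//; move: (c n) `|bp nu (j n)| c0 pj => u v u0 v0.
  by field; rewrite !gt_eqF.
apply: cvgM; first exact: cvg_cst.
exact: profile_at0.
Qed.

Lemma Phi_cvg1 n : (0 < n)%N ->
  Phi alpha n x @[x --> 1^'-] -->
    Num.sqrt (2 - alpha) * bp nu (j n) / `|bp nu (j n)|.
Proof.
move=> n0; have j0 := besselJ_zero_gt0 nu_ge0 n0.
have qj := bq_besselJ_zero nu_ge0 n0.
have pj : 0 < `|bp nu (j n)| by rewrite normr_gt0 (bp_neq0 nu_ge0).
have c0 : 0 < c n by rewrite mulr_gt0 ?cplus0_gt0// powR_gt0.
have -> : Num.sqrt (2 - alpha) * bp nu (j n) / `|bp nu (j n)| =
    K_ alpha n * (c n * bp nu (j n)).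
  rewrite K_eq//; move: (c n) `|bp nu (j n)| c0 pj => u v u0 v0.
  by field; rewrite !gt_eqF.
apply: cvgM; first exact: cvg_cst.
exact: profile_at1.
Qed.

Lemma Phi_at0E n : (0 < n)%N ->
  Phi_at0 alpha n = Num.sqrt (2 - alpha) / `|bp nu (j n)|.
Proof. by move=> /Phi_cvg0 h; apply/cvg_lim. Qed.

Lemma Phi_at1_norm n : (0 < n)%N -> `|Phi_at1 alpha n| = Num.sqrt (2 - alpha).
Proof.
move=> n0; rewrite /Phi_at1 (cvg_lim _ (Phi_cvg1 n0))//.
have pj : bp nu (j n) != 0.
  apply: (bp_neq0 nu_ge0); [exact: (besselJ_zero_gt0 nu_ge0 n0)|].
  exact: (bq_besselJ_zero nu_ge0 n0).
rewrite !normrM normfV normr_id mulfK ?normr_eq0//.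
by rewrite ger0_norm// sqrtr_ge0.
Qed.

(** The ratio is a function of the quantity whose limit is
[bp_at_zeros_lim]. *)
Lemma Phi_at0_ratio n : (0 < n)%N -> Phi_at0 alpha n /
    (cplus0 nu * Num.sqrt ((2 - alpha) * pi / 2) * j n `^ (1 / 2 + nu)) =
  (Num.sqrt (pi / 2 * cplus0 nu ^+ 2 *
     (j n `^ (2 * nu + 1) * bp nu (j n) ^+ 2)))^-1.
Proof.
move=> n0; rewrite Phi_at0E//; have j0 := besselJ_zero_gt0 nu_ge0 n0.
have qj := bq_besselJ_zero nu_ge0 n0.
have pj : 0 < `|bp nu (j n)| by rewrite normr_gt0 (bp_neq0 nu_ge0).
have c0 := cplus0_gt0; have a2 := alpha_lt2.
have s0 : 0 < Num.sqrt (2 - alpha) by rewrite sqrtr_gt0.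
have pi2 : 0 < pi / 2 :> R by rewrite divr_gt0// pi_gt0.
have sp : 0 < Num.sqrt (pi / 2 : R) by rewrite sqrtr_gt0.
have jp : 0 < j n `^ (1 / 2 + nu) by rewrite powR_gt0.
rewrite (_ : (2 - alpha) * pi / 2 = (2 - alpha) * (pi / 2)); last by rewrite mulrA.
rewrite sqrtrM ?(ltW a2)//.
have -> : pi / 2 * cplus0 nu ^+ 2 * (j n `^ (2 * nu + 1) * bp nu (j n) ^+ 2) =
    pi / 2 * (cplus0 nu * (j n `^ (1 / 2 + nu) * bp nu (j n))) ^+ 2.
  have -> : j n `^ (2 * nu + 1) = (j n `^ (1 / 2 + nu)) ^+ 2.
    by rewrite -powR_mulrn ?(ltW jp)// -powRrM; congr (_ `^ _); field.
  by ring.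
rewrite [in RHS]sqrtrM ?(ltW pi2)// sqrtr_sqr (normrM (cplus0 nu)) (gtr0_norm c0).
rewrite (normrM (_ `^ _)) (gtr0_norm jp).
move: (cplus0 nu) (Num.sqrt (pi / 2)) (Num.sqrt (2 - alpha)) (_ `^ _)
  `|bp nu (j n)| c0 sp s0 jp pj => u v w x z u0 v0 w0 x0 z0.
by field; rewrite !gt_eqF.
Qed.

Lemma Phi_at0_asymp : (fun n : nat => Phi_at0 alpha n /
    (cplus0 nu * Num.sqrt ((2 - alpha) * pi / 2) * j n `^ (1 / 2 + nu))) @ \oo
  --> (1 : R).
Proof.
have H : (Num.sqrt (pi / 2 * cplus0 nu ^+ 2 *
     (j n `^ (2 * nu + 1) * bp nu (j n) ^+ 2)))^-1 @[n --> \oo] --> (1 : R).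
  rewrite -[X in _ --> X]invr1; apply: cvgV; first exact: oner_neq0.
  rewrite -[X in _ --> X]sqrtr1.
  apply: continuous_cvg; first exact: sqrt_continuous.
  have E : pi / 2 * cplus0 nu ^+ 2 *
      (2 / pi * (2 `^ nu * Gamma (nu + 1)) ^+ 2) = 1 :> R.
    have G0 : 0 < Gamma (nu + 1) by rewrite Gamma_gt0// lerDr nu_ge0.
    have p0 : 0 < 2 `^ nu :> R by rewrite powR_gt0.
    rewrite /cplus0; have pi0 := @pi_gt0 R.
    move: (pi : R) pi0 => p pn0.
    by field; rewrite !gt_eqF.
  have C := cvgM (cvg_cst (pi / 2 * cplus0 nu ^+ 2)) (bp_at_zeros_lim nu_ge0).
  rewrite E in C; exact: C.
rewrite -(cvg_shiftn 1%N) in H; rewrite -(cvg_shiftn 1%N).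
have -> // : (fun n : nat => Phi_at0 alpha (n + 1) /
    (cplus0 nu * Num.sqrt ((2 - alpha) * pi / 2) * j (n + 1)%N `^ (1 / 2 + nu))) =
  (fun n : nat => (Num.sqrt (pi / 2 * cplus0 nu ^+ 2 *
     (j (n + 1)%N `^ (2 * nu + 1) * bp nu (j (n + 1)%N) ^+ 2)))^-1).
by apply/funext => n; rewrite Phi_at0_ratio// addn1.
Qed.

(** [Phi 0] is equivalent to a positive multiple of [j ^ (1/2 + nu)], which is
at least [sqrt j]. *)
Lemma Phi_at0_unbounded :
  ~ [bounded Phi_at0 alpha n | n in [set n : nat | (1 <= n)%N]].
Proof.
move=> [M [_ MP]].
have {MP} B n : (0 < n)%N -> `|Phi_at0 alpha n| <= M + 1.
  by apply: MP; rewrite ltrDl.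
pose k := cplus0 nu * Num.sqrt ((2 - alpha) * pi / 2).
have k0 : 0 < k.
  apply: mulr_gt0; first exact: cplus0_gt0.
  by rewrite sqrtr_gt0 divr_gt0// mulr_gt0 ?alpha_lt2// pi_gt0.
have := Phi_at0_asymp; move=> /cvgrPdist_lt /(_ (1 / 2)).
rewrite divr_gt0// => /(_ isT) near1.
have := besselJ_zero_cvgy nu_ge0 => /cvgryPgt /(_ (Num.max 1 ((2 * (M + 1) / k) ^+ 2))).
move=> near2.
near \oo => n.
have n0 : (0 < n)%N by near: n; exact: nbhs_infty_gt.
have : `|1 - Phi_at0 alpha n / (k * j n `^ (1 / 2 + nu))| < 1 / 2 by near: n.
have : Num.max 1 ((2 * (M + 1) / k) ^+ 2) < j n by near: n.
rewrite gt_max => /andP[j1 jM] h.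
have jp : 0 < j n `^ (1 / 2 + nu) by rewrite powR_gt0// (lt_trans ltr01).
have h1 : k * j n `^ (1 / 2 + nu) < 2 * (M + 1).
  have : 1 / 2 < Phi_at0 alpha n / (k * j n `^ (1 / 2 + nu)).
    move: h; rewrite ltr_norml => /andP[_]; lra.
  rewrite ltr_pdivlMr; last exact: (mulr_gt0 k0 jp).
  move=> h2.
  have := lt_le_trans h2 (le_trans (ler_norm _) (B n n0)); lra.
have h3 : j n `^ (1 / 2 + nu) < 2 * (M + 1) / k by rewrite ltr_pdivlMr// mulrC.
have h4 : Num.sqrt (j n) <= j n `^ (1 / 2 + nu).
  rewrite -powR12_sqrt ?(le_trans ler01 (ltW j1))// div1r.
  by apply: ler_powR; rewrite ?(ltW j1)// lerDl nu_ge0.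
have h5 : Num.sqrt (j n) < 2 * (M + 1) / k by exact: le_lt_trans h3.
have h6 : j n < (2 * (M + 1) / k) ^+ 2.
  rewrite -[j n]sqr_sqrtr ?(le_trans ler01 (ltW j1))//.
  by rewrite ltrXn2r// nnegrE ?sqrtr_ge0// (le_trans (sqrtr_ge0 _) (ltW h5)).
by move: h6; rewrite ltNge (ltW jM).
Unshelve. all: by end_near. Qed.

End eigenfunctions.

Theorem lemma5p2 (R : realType) (alpha : R) (halpha : 1 <= alpha < 2) :
  [/\ forall n : nat, (1 <= n)%N ->
        cvg (Phi alpha n x @[x --> 0^'+]) /\ cvg (Phi alpha n x @[x --> 1^'-]),
      forall n : nat, (1 <= n)%N -> `|Phi_at1 alpha n| = Num.sqrt (2 - alpha),
      (fun n : nat => Phi_at0 alpha n /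
         (cplus0 (nu_ alpha) * Num.sqrt ((2 - alpha) * pi / 2) *
          besselJ_zero (nu_ alpha + 1) n `^ (1 / 2 + nu_ alpha))) @ \oo --> (1 : R)
    & ~ [bounded Phi_at0 alpha n | n in [set n : nat | (1 <= n)%N]]].
Proof.
split.
- move=> n n1; split; apply/cvg_ex; eexists;
    [exact: (Phi_cvg0 halpha n1)|exact: (Phi_cvg1 halpha n1)].
- exact: (Phi_at1_norm halpha).
- exact: (Phi_at0_asymp halpha).
- exact: (Phi_at0_unbounded halpha).
Qed.
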